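(* For $0\le t\le 1$ let $f_t:\Omega_{2,2}^{I}\to\Omega_{4,4}^{I}$ be the proper holomorphic map $$ f_t\begin{pmatrix} z_1 & z_2\\ z_3& z_4\end{pmatrix}= \begin{pmatrix} z_1^2 & \sqrt{2-t}\,z_1z_2 & \sqrt{1-t}\, z_2^2& \sqrt{t}\,z_2 \\ \sqrt{2-t}\,z_1z_3 & \frac{2(1-t)}{2-t}z_1z_4 + z_2z_3& 2\sqrt{\frac{1-t}{2-t}}\,z_2z_4& \sqrt{\frac{t}{2-t}}\,z_4 \\ \sqrt{1-t}\,z_3^2 & 2\sqrt{\frac{1-t}{2-t}}\,z_3z_4& z_4^2& 0 \\ \sqrt{t}\,z_3 & \sqrt{\frac{t}{2-t}}\,z_4&0&0 \end{pmatrix}. $$ Then the maps $f_t$, $0\le t\le 1$, are inequivalent for different $t$; that is, for all $s,t\in[0,1]$ with $s\ne t$, the maps $f_s$ and $f_t$ are not equivalent.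
   Context: For integers $s\ge r\ge 1$, $\Omega_{r,s}^{I} = \{ Z\in M_{r,s}^{\mathbb{C}} : I_r - ZZ^* >0 \}$, where $M_{r,s}^{\mathbb{C}}$ is the set of $r\times s$ complex matrices, $I_r$ is the identity matrix, $Z^*$ is the conjugate transpose, and $>0$ means positive definite. A map between domains is proper if preimages of compact sets are compact. That each $f_t$ is a well-defined proper holomorphic map from $\Omega_{2,2}^{I}$ to $\Omega_{4,4}^{I}$ is known from earlier work. $\mathrm{Aut}(\Omega)$ is the group of holomorphic automorphisms (biholomorphic self-maps) of $\Omega$. Holomorphic maps $f,g:\Omega_1\to\Omega_2$ are equivalent if $f=A\circ g\circ B$ for some $A\in\mathrm{Aut}(\Omega_2)$ and $B\in\mathrm{Aut}(\Omega_1)$. *)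

(* Defs.v *)
From HB Require Import structures.
From mathcomp Require Import all_boot all_order all_algebra.
From mathcomp Require Import complex.
From mathcomp Require Import all_classical all_reals all_analysis.

Set Implicit Arguments.
Unset Strict Implicit.
Unset Printing Implicit Defensive.

Import Order.TTheory GRing.Theory Num.Theory.
Import numFieldNormedType.Exports.

Local Open Scope classical_set_scope.
Local Open Scope ring_scope.
Local Open Scope complex_scope.
Local Open Scope sesquilinear_scope.

(* [0 < x] in a [numClosedFieldType] means that [x] is real and positive. *)
Definition posdefmx (C : numClosedFieldType) (n : nat) (A : 'M[C]_n) : Prop :=
  A \is hermsymmx /\
  forall v : 'cV[C]_n, v != 0 -> 0 < (v ^t* *m A *m v) 0 0.

Definition OmegaI (C : numClosedFieldType) (r s : nat) : set 'M[C]_(r, s) :=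
  [set Z | posdefmx (1%:M - Z *m Z ^t*)].
Arguments OmegaI : clear implicits.

(* [differentiable] is Frechet differentiability over the scalar field of the
   normed module; over [C := R[i]] and on an open set this is holomorphy. *)
Definition holomorphic_on (C : numClosedFieldType) (m n p q : nat)
    (D : set 'M[C]_(m, n)) (f : 'M[C]_(m, n) -> 'M[C]_(p, q)) : Prop :=
  forall Z, D Z -> differentiable f Z.

(* Maps between domains are represented by total functions on matrices, of
   which only the values on the source domain are relevant. *)
Definition is_aut (C : numClosedFieldType) (m n : nat) (D : set 'M[C]_(m, n))
    (f : 'M[C]_(m, n) -> 'M[C]_(m, n)) : Prop :=
  [/\ set_fun D D f, holomorphic_on D f &
      exists g : 'M[C]_(m, n) -> 'M[C]_(m, n),
        [/\ set_fun D D g, holomorphic_on D g,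
            forall Z, D Z -> g (f Z) = Z & forall Z, D Z -> f (g Z) = Z]].

Definition equivalent_maps (C : numClosedFieldType) (m n p q : nat)
    (D1 : set 'M[C]_(m, n)) (D2 : set 'M[C]_(p, q))
    (f g : 'M[C]_(m, n) -> 'M[C]_(p, q)) : Prop :=
  exists A B, [/\ is_aut D2 A, is_aut D1 B &
    forall Z, D1 Z -> f Z = A (g (B Z))].

Definition mx_of_rows (R : realType) (m n : nat) (rows : seq (seq R[i])) :
    'M[R[i]]_(m, n) :=
  \matrix_(i < m, j < n) (nth [::] rows i)`_j.

Definition f_ (R : realType) (t : R) (Z : 'M[R[i]]_(2, 2)) : 'M[R[i]]_(4, 4) :=
  let z1 := Z 0 0 in let z2 := Z 0 1 in
  let z3 := Z 1 0 in let z4 := Z 1 1 in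
  mx_of_rows 4 4
  [:: [:: z1 ^+ 2;
          (Num.sqrt (2 - t))%:C * z1 * z2;
          (Num.sqrt (1 - t))%:C * z2 ^+ 2;
          (Num.sqrt t)%:C * z2];
      [:: (Num.sqrt (2 - t))%:C * z1 * z3;
          (2 * (1 - t) / (2 - t))%:C * z1 * z4 + z2 * z3;
          (2 * Num.sqrt ((1 - t) / (2 - t)))%:C * z2 * z4;
          (Num.sqrt (t / (2 - t)))%:C * z4];
      [:: (Num.sqrt (1 - t))%:C * z3 ^+ 2;
          (2 * Num.sqrt ((1 - t) / (2 - t)))%:C * z3 * z4;
          z4 ^+ 2;
          0];
      [:: (Num.sqrt t)%:C * z3;
          (Num.sqrt (t / (2 - t)))%:C * z4;
          0;
          0]].

(* Main.v *)
Require Import Defs.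
From mathcomp Require Import all_boot all_order all_algebra.
From mathcomp Require Import complex ring lra.
From mathcomp Require Import all_classical all_reals all_analysis.

(** Suppose [f_ t = A \o f_ s \o B] with [s < t] (the other case follows by
inverting [A] and [B], which is legitimate because [f_self_map] shows that the
maps send the source domain to the target domain).

The differential of [f_ t] at [0] kills the matrix unit in position (0, 0), so
the differential of [f_ s] at [B 0] kills a nonzero vector.  Since [s < 1], the
map [f_ s] is an immersion away from the origin ([critical_points]), whence
[B 0 = 0] and then [A 0 = 0].

The domains are the open unit balls of matrix spaces for the operator norm, so
by the Schwarz lemma ([schwarz_contraction]) the differentials at [0] of [A] and
[B] do not increase operator norms.  The differential of [f_ s] at [0] has norm
[sqrt s]: it is [sqrt s] times a map that preserves contractions
([f_differential_at_zero], [linear_part_contraction]), and it multiplies the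
norm of the matrix unit in position (0, 1) by exactly [sqrt s].  Hence
[sqrt t <= sqrt s], a contradiction.

The Schwarz lemma is proved from pointwise complex differentiability alone.
In the logarithmic coordinate [u] with [z = exp u], the quotient [f z / z]
becomes a holomorphic function of [u] with period [2 * pi * i] on a half plane.
Goursat's lemma ([goursat]) on a rectangle one period high then says that the
mean of its real part over a vertical segment does not depend on the segment,
because the two horizontal sides cancel.  Far to the left this mean tends to the
real part of the derivative of [f] at [0]; near the imaginary axis it is at most
the bound on [f] ([punctured_disc_Re_le], [schwarz_Re]).  Line integrals only
enter as increments of primitives, so the estimates are mean value
inequalities. *)

Set Implicit Arguments.
Unset Strict Implicit.
Unset Printing Implicit Defensive.
Import Order.TTheory GRing.Theory Num.Theory.
Import numFieldNormedType.Exports.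
Import Normc.
Local Open Scope classical_set_scope.
Local Open Scope ring_scope.
Local Open Scope sesquilinear_scope.

(** * Primitives of continuous functions *)

Lemma continuous_primitive (R : realType) (f : R -> R) (a b : R) : a < b ->
  (forall x, a <= x <= b -> {for x, continuous f}) ->
  exists F : R -> R, forall x, a < x < b -> is_derive x 1 F (f x).
Proof.
move=> ab cf.
exists (fun x => (\int[lebesgue_measure]_(t in [set` `[a, x]]) f t)%R) => x.
move=> /andP[ax xb].
have intf : lebesgue_measure.-integrable `[a, b] (EFin \o f).
  apply: continuous_compact_integrable; first exact: segment_compact.
  apply: continuous_in_subspaceT => y; rewrite inE /= in_itv /= => yab.
  exact: cf.
have [] := continuous_FTC1_closed xb intf ax _.
  by apply: cf; rewrite !ltW.
by move=> dF F'; apply: DeriveDef => //; rewrite -derive1E.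
Qed.

Lemma increment_le (R : realType) (F f : R -> R) (a h e : R) : 0 <= h ->
  (forall x, a <= x <= a + h -> is_derive x 1 F (f x)) ->
  (forall x, a <= x <= a + h -> f x <= e) ->
  F (a + h) - F a <= e * h.
Proof.
move=> h0 dF fe; have ab : a <= a + h by rewrite lerDl.
have [||c] := @MVT_segment R F f a (a + h) ab.
- by move=> x; rewrite in_itv /= => /andP[? ?]; apply: dF; rewrite !ltW.
- apply: derivable_within_continuous => x; rewrite in_itv /= => xab.
  by have := dF x xab; move=> ?; apply: ex_derive.
rewrite in_itv /= => cab ->; rewrite addrAC subrr add0r.
by apply: ler_wpM2r => //; exact: fe.
Qed.

(** This replaces the integration of a first order expansion along one edge of
a rectangle: the second term is the increment of the primitive of the affine
part. *)
Lemma increment_near_affine (R : realType) (F f : R -> R)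
    (a h e x0 c0 c1 : R) : 0 <= h ->
  (forall x, a <= x <= a + h -> is_derive x 1 F (f x)) ->
  (forall x, a <= x <= a + h -> `|f x - (c0 + c1 * (x - x0))| <= e) ->
  `|F (a + h) - F a - (c0 * h + c1 * ((a + h - x0) ^+ 2 - (a - x0) ^+ 2) / 2)|
    <= e * h.
Proof.
move=> h0 dF fe.
pose L x := c0 * x + c1 / 2 * (x - x0) ^+ 2.
have dL (x : R) : is_derive x 1 L (c0 + c1 * (x - x0)).
  rewrite /L; apply: is_derive_eq.
  by rewrite !scaler1 ?subr0 ?mulr1 -?[_ *: _]/(_ * _) /=; lra.
have LE : L (a + h) - L a =
    c0 * h + c1 * ((a + h - x0) ^+ 2 - (a - x0) ^+ 2) / 2.
  by rewrite /L; lra.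
rewrite -LE ler_norml -lerNl.
have up (F' f' : R -> R) :
  (forall x, a <= x <= a + h -> is_derive x 1 F' (f' x)) ->
  (forall x, a <= x <= a + h -> f' x <= e) -> F' (a + h) - F' a <= e * h.
  exact: increment_le.
apply/andP; split.
- have := up (fun x => L x - F x) (fun x => c0 + c1 * (x - x0) - f x).
  have -> : L (a + h) - F (a + h) - (L a - F a) = - (F (a + h) - F a - (L (a + h) - L a)) by ring.
  apply=> x xab; first by have ? := dF x xab; apply: is_derive_eq.
  by have := fe x xab; rewrite ler_norml => /andP[+ _]; lra.
- have := up (fun x => F x - L x) (fun x => f x - (c0 + c1 * (x - x0))).
  have -> : F (a + h) - L (a + h) - (F a - L a) = (F (a + h) - F a - (L (a + h) - L a)) by ring.
  apply=> x xab; first by have ? := dF x xab; apply: is_derive_eq.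
  by have := fe x xab; rewrite ler_norml => /andP[_]; lra.
Qed.

(** * Goursat's lemma on a rectangle *)

(** The supremum of the left ends works, since every left end lies below every
right end; this is how nested intervals are intersected below. *)
Lemma halving_point (R : realType) (x : nat -> R) (w : R) :
  (forall n, x n <= x n.+1 <= x n + w / 2 ^+ n.+1) -> 
  exists xi, forall n, x n <= xi <= x n + w / 2 ^+ n.
Proof.
move=> hx.
have inc : {homo x : n m / (n <= m)%N >-> n <= m}.
  by apply/nondecreasing_seqP => n; case/andP: (hx n).
have dec : {homo (fun n => x n + w / 2 ^+ n) : n m / (n <= m)%N >-> m <= n}.
  apply/nonincreasing_seqP => n; case/andP: (hx n) => _.
  have -> : w / 2 ^+ n = w / 2 ^+ n.+1 + w / 2 ^+ n.+1.
    have ? : (2 : R) ^+ n != 0 by rewrite expf_neq0.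
    by rewrite exprS; field.
  by lra.
have w0 : 0 <= w by have := hx 0%N; rewrite expr1; lra.
have ub n m : x m <= x n + w / 2 ^+ n.
  have [nm|/ltnW mn] := leqP n m.
    apply: le_trans (dec _ _ nm); rewrite lerDl divr_ge0 // exprn_ge0 //.
  apply: le_trans (inc _ _ mn) _; rewrite lerDl divr_ge0 // exprn_ge0 //.
exists (sup (range x)) => n; apply/andP; split.
  apply: sup_ubound; last by exists n.
  by exists (x 0%N + w / 2 ^+ 0) => _ [m _ <-]; exact: ub.
apply: ge_sup; first by exists (x 0%N), 0%N.
by move=> _ [m _ <-]; exact: ub.
Qed.

(** Cousin's principle in dimension two.  If [T] failed on the rectangle, it
would fail on one of its quarters, and so on; the nested bad rectangles shrink to
a point, near which [T] holds by assumption. *)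
Lemma rectangle_induction (R : realType) (T : R -> R -> R -> R -> Prop)
    (x y w h : R) :
  0 <= w -> 0 <= h ->
  (forall x' y' w' h', x <= x' -> y <= y' -> x' + (w' + w') <= x + w ->
    y' + (h' + h') <= y + h -> 0 <= w' -> 0 <= h' ->
    T x' y' w' h' -> T (x' + w') y' w' h' -> T x' (y' + h') w' h' ->
    T (x' + w') (y' + h') w' h' -> T x' y' (w' + w') (h' + h')) ->
  (forall p q, x <= p <= x + w -> y <= q <= y + h ->
    exists2 d, 0 < d & forall x' y' w' h', x <= x' -> y <= y' ->
      x' + w' <= x + w -> y' + h' <= y + h ->
      x' <= p <= x' + w' -> y' <= q <= y' + h' -> w' < d -> h' < d ->
      T x' y' w' h') ->
  T x y w h.
Proof.
move=> w0 h0 split loc; apply: contrapT => nT.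
pose W n := w / 2 ^+ n; pose H n := h / 2 ^+ n.
have WS n : W n = W n.+1 + W n.+1.
  have ? : (2 : R) ^+ n != 0 by rewrite expf_neq0.
  by rewrite /W exprS; field.
have HS n : H n = H n.+1 + H n.+1.
  have ? : (2 : R) ^+ n != 0 by rewrite expf_neq0.
  by rewrite /H exprS; field.
have W0 n : 0 <= W n by rewrite divr_ge0 // exprn_ge0.
have H0 n : 0 <= H n by rewrite divr_ge0 // exprn_ge0.
pose good n (u : R * R) := [/\ x <= u.1, y <= u.2, u.1 + W n <= x + w,
  u.2 + H n <= y + h & ~ T u.1 u.2 (W n) (H n)].
have step n (u : R * R) : exists v : R * R, good n u ->
   [/\ good n.+1 v, u.1 <= v.1 <= u.1 + W n.+1 & u.2 <= v.2 <= u.2 + H n.+1].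
  have [|bad] := pselect (good n u); last by exists u => /bad.
  rewrite /good; case: u => p q /= [xp yq pw qh]; rewrite WS HS => nTpq.
  move: pw qh; rewrite WS HS => pw qh.
  have := W0 n.+1; have := H0 n.+1; move: (W n.+1) (H n.+1) nTpq pw qh.
  move=> w' h' nTpq pw qh h'0 w'0.
  have [t1|n1] := pselect (T p q w' h'); last first.
    by exists (p, q) => _ /=; split; [split=> //| |]; lra.
  have [t2|n1] := pselect (T (p + w') q w' h'); last first.
    by exists (p + w', q) => _ /=; split; [split=> //| |]; lra.
  have [t3|n1] := pselect (T p (q + h') w' h'); last first.
    by exists (p, q + h') => _ /=; split; [split=> //| |]; lra.
  have [t4|n1] := pselect (T (p + w') (q + h') w' h'); last first.
    by exists (p + w', q + h') => _ /=; split; [split=> //| |]; lra.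
  by case: nTpq; apply: split => //; lra.
pose nxt n u := sval (cid (step n u)).
pose u := fix u n := if n is m.+1 then nxt m (u m) else (x, y).
have gu n : good n (u n).
  elim: n => [|n ih]; first by rewrite /good /= /W /H expr0 !divr1.
  by rewrite /= /nxt; case: cid => v /= /(_ ih)[].
have su n : (u n).1 <= (u n.+1).1 <= (u n).1 + W n.+1 /\
    (u n).2 <= (u n.+1).2 <= (u n).2 + H n.+1.
  by have := gu n; rewrite /= /nxt; case: cid => v /= + gn => /(_ gn)[].
have [p hp] := @halving_point R (fun n => (u n).1) w (fun n => (su n).1).
have [q hq] := @halving_point R (fun n => (u n).2) h (fun n => (su n).2).
have [||d d0 hd] := loc p q.
- by have := hp 0%N; rewrite expr0 divr1.
- by have := hq 0%N; rewrite expr0 divr1.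
have [n hn] : exists n, w + h < d * 2 ^+ n.
  exists (Num.Def.archi_bound ((w + h) / d)).
  by rewrite mulrC -ltr_pdivrMr //; apply: upper_nthrootP.
have [xn yn xwn yhn] := gu n; apply; apply: hd => //.
- rewrite /W ltr_pdivrMr ?exprn_gt0 //; lra.
- rewrite /H ltr_pdivrMr ?exprn_gt0 //; lra.
Qed.

(** The line integral of [P dx + Q dy] around a rectangle, when [G y] is a
primitive of [P] on the horizontal line at height [y] and [K x] one of [Q] on the
vertical line at abscissa [x]. *)
Definition circulation (R : realType) (G K : R -> R -> R) (x y w h : R) : R :=
  (G y (x + w) - G y x) + (K (x + w) (y + h) - K (x + w) y)
  - (G (y + h) (x + w) - G (y + h) x) - (K x (y + h) - K x y).

(** The expansions say that [P] and [Q] are differentiable at each point and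
that the closedness condition (the common coefficient [b]) holds there; nothing
is assumed on the continuity of the derivatives.  On a small rectangle the affine
parts contribute nothing to the circulation, precisely because of the common
[b], and the remainders contribute at most [2 * e * (w + h) ^+ 2].  This bound is
reproduced by the subdivision into four quarters of half the perimeter, so it
holds on the whole rectangle, for every [e]. *)
Lemma goursat (R : realType) (P Q G K : R -> R -> R) (x y w h : R) :
  0 <= w -> 0 <= h ->
  (forall p q, x <= p <= x + w -> y <= q <= y + h ->
    is_derive p 1 (G q) (P p q)) ->
  (forall p q, x <= p <= x + w -> y <= q <= y + h ->
    is_derive q 1 (K p) (Q p q)) ->
  (forall p q, x <= p <= x + w -> y <= q <= y + h -> exists a b c : R,
    forall e, 0 < e -> exists2 d, 0 < d & forall p' q',
      x <= p' <= x + w -> y <= q' <= y + h -> `|p' - p| < d -> `|q' - q| < d ->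
      `|P p' q' - (P p q + a * (p' - p) + b * (q' - q))|
         <= e * (`|p' - p| + `|q' - q|) /\
      `|Q p' q' - (Q p q + b * (p' - p) + c * (q' - q))|
         <= e * (`|p' - p| + `|q' - q|)) ->
  circulation G K x y w h = 0.
Proof.
move=> w0 h0 dG dK dPQ.
suff small e : 0 < e ->
    `|circulation G K x y w h| <= e * (2 * (w + h) ^+ 2).
  apply/eqP; rewrite -normr_le0; apply/ler_addgt0Pl => e e0; rewrite addr0.
  have s0 : 0 <= 2 * (w + h) ^+ 2 by rewrite mulr_ge0 ?sqr_ge0.
  apply: le_trans (small (e / (2 * (w + h) ^+ 2 + 1)) _) _.
    by rewrite divr_gt0 // ltr_wpDl.
  rewrite mulrAC ler_pdivrMr ?ltr_wpDl // ler_wpM2l ?(ltW e0) //.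
  by rewrite lerDl.
move=> e0; pose T x y w h :=
  `|circulation G K x y w h| <= e * (2 * (w + h) ^+ 2) :> R.
apply: (@rectangle_induction R T) => //; rewrite {}/T.
- move=> x' y' w' h' _ _ _ _ _ _ t1 t2 t3 t4.
  have -> : circulation G K x' y' (w' + w') (h' + h') =
      (circulation G K x' y' w' h' + circulation G K (x' + w') y' w' h') +
      (circulation G K x' (y' + h') w' h' +
       circulation G K (x' + w') (y' + h') w' h').
    by rewrite /circulation !addrA; ring.
  have -> : e * (2 * (w' + w' + (h' + h')) ^+ 2) =
     (e * (2 * (w' + h') ^+ 2) + e * (2 * (w' + h') ^+ 2)) +
     (e * (2 * (w' + h') ^+ 2) + e * (2 * (w' + h') ^+ 2)) by ring.
  by do 2 (apply: le_trans (ler_normD _ _) _; apply: lerD) => //;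
     apply: le_trans (ler_normD _ _) _; apply: lerD.
move=> p q hp hq; have [a [b [c hd]]] := dPQ p q hp hq.
have [d d0 {}hd] := hd e e0; exists d => // x' y' w' h' xx yy xw yh px qy wd hd'.
have w'0 : 0 <= w' by lra.
have h'0 : 0 <= h' by lra.
have bnd p' q' : x' <= p' <= x' + w' -> y' <= q' <= y' + h' ->
    [/\ x <= p' <= x + w, y <= q' <= y + h, `|p' - p| < d, `|q' - q| < d &
    e * (`|p' - p| + `|q' - q|) <= e * (w' + h')].
  move=> hp' hq'.
  have pw : `|p' - p| <= w' by rewrite ler_norml; lra.
  have qh : `|q' - q| <= h' by rewrite ler_norml; lra.
  split; try lra.
  by apply: ler_wpM2l; lra.
have PE p' q' : x' <= p' <= x' + w' -> y' <= q' <= y' + h' ->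
    `|P p' q' - (P p q + b * (q' - q) + a * (p' - p))| <= e * (w' + h').
  move=> hp' hq'; have [b1 b2 b3 b4] := bnd _ _ hp' hq'; apply: le_trans.
  by have [+ _] := hd p' q' b1 b2 b3 b4; rewrite addrAC.
have QE p' q' : x' <= p' <= x' + w' -> y' <= q' <= y' + h' ->
    `|Q p' q' - (Q p q + b * (p' - p) + c * (q' - q))| <= e * (w' + h').
  move=> hp' hq'; have [b1 b2 b3 b4] := bnd _ _ hp' hq'; apply: le_trans.
  by have [_] := hd p' q' b1 b2 b3 b4.
have eG q' : y' <= q' <= y' + h' -> 
   `|G q' (x' + w') - G q' x' - ((P p q + b * (q' - q)) * w' +
      a * ((x' + w' - p) ^+ 2 - (x' - p) ^+ 2) / 2)| <= e * (w' + h') * w'.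
  move=> hq'; apply: (@increment_near_affine R _ (fun p' => P p' q')) => //.
    by move=> p' hp'; apply: dG; lra.
  by move=> p' hp'; exact: PE.
have eK p' : x' <= p' <= x' + w' -> 
   `|K p' (y' + h') - K p' y' - ((Q p q + b * (p' - p)) * h' +
      c * ((y' + h' - q) ^+ 2 - (y' - q) ^+ 2) / 2)| <= e * (w' + h') * h'.
  move=> hp'; apply: (@increment_near_affine R _ (fun q' => Q p' q')) => //.
    by move=> q' hq'; apply: dK; lra.
  by move=> q' hq'; exact: QE.
have := eG y'; have := eG (y' + h'); have := eK x'; have := eK (x' + w').
rewrite /circulation !lexx !lerDl w'0 h'0 => /(_ isT) k1 /(_ isT) k2 /(_ isT) k3 /(_ isT) k4.
have -> : e * (2 * (w' + h') ^+ 2) = 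
  e * (w' + h') * w' + e * (w' + h') * h' + e * (w' + h') * w' + e * (w' + h') * h'.
  by ring.
set g1 := (X in `|X|) in k1; set g2 := (X in `|X|) in k2.
set g3 := (X in `|X|) in k3; set g4 := (X in `|X|) in k4.
have -> : (G y' (x' + w') - G y' x' + (K (x' + w') (y' + h') - K (x' + w') y') -
   (G (y' + h') (x' + w') - G (y' + h') x') - (K x' (y' + h') - K x' y')) =
   g4 + g1 - g3 - g2.
  by rewrite /g1 /g2 /g3 /g4; ring.
do 3 (apply: le_trans (ler_normB _ _) _ || apply: le_trans (ler_normD _ _) _; apply: lerD => //).
Qed.

(** * Complex derivatives *)

(** The derivative as a first order expansion.  It mentions nothing but the
field itself, so it specializes to [R[i]] without having to choose between the
scalars [R] and [R[i]], and it gives real estimates directly. *)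
Definition has_cderiv (C : numFieldType) (f : C -> C) (z d : C) : Prop :=
  forall e, 0 < e -> exists2 r, 0 < r & forall w, `|w - z| < r ->
    `|f w - f z - d * (w - z)| <= e * `|w - z|.

Lemma has_cderivP (C : numFieldType) (f : C -> C) (z d : C) :
  has_cderiv f z d <-> is_derive z 1 f d.
Proof.
have quotE (h : C) : h != 0 ->
    `|d - h^-1 *: (f (h *: 1 + z) - f z)| = `|f (h + z) - f z - d * h| / `|h|.
  move=> h0; rewrite [h *: 1]mulr1 -normf_div -normrN; congr (`| _ |).
  by rewrite -[_ *: _]/(_ * _); field.
split=> [fd | [df fE]].
  have cv : h^-1 *: (f (h *: 1 + z) - f z) @[h --> 0^'] --> d.
    apply/cvgrPdist_le => e e0; have [r r0 hr] := fd e e0.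
    near=> h.
    have h0 : h != 0 by near: h; exact: nbhs_dnbhs_neq.
    rewrite quotE // ler_pdivrMr ?normr_gt0 //.
    have -> : h = (h + z) - z by rewrite addrK.
    rewrite subrK; apply: hr; rewrite addrK.
    by near: h; exact: dnbhs0_lt.
  by apply: DeriveDef; [apply/cvg_ex; exists d | exact: cvg_lim].
move=> e e0; have cv : h^-1 *: (f (h *: 1 + z) - f z) @[h --> 0^'] --> d.
  by rewrite -fE; exact: df.
have /cvgrPdist_le /(_ e e0) [/= r r0 hr] := cv.
exists r => // w wr; have [->|wz] := eqVneq w z.
  by rewrite !subrr mulr0 subrr normr0 mulr0.
have wz0 : w - z != 0 by rewrite subr_eq0.
have := hr (w - z); rewrite /= sub0r normrN quotE // subrK.
by rewrite ler_pdivrMr ?normr_gt0 //; apply.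
Unshelve. all: by end_near. Qed.

Section calculus.
Context (C : numFieldType).
Implicit Types (f g : C -> C) (z d : C).

Lemma has_cderiv_cst c z : has_cderiv (fun=> c) z 0.
Proof. by apply/has_cderivP; exact: is_derive_cst. Qed.

Lemma has_cderiv_id z : has_cderiv id z 1.
Proof. by apply/has_cderivP; exact: is_derive_id. Qed.

Lemma has_cderivD f g z d d' : has_cderiv f z d -> has_cderiv g z d' ->
  has_cderiv (fun w => f w + g w) z (d + d').
Proof. by move=> /has_cderivP df /has_cderivP dg; apply/has_cderivP; exact: is_deriveD. Qed.

Lemma has_cderivM f g z d d' : has_cderiv f z d -> has_cderiv g z d' ->
  has_cderiv (fun w => f w * g w) z (f z * d' + g z * d).
Proof. by move=> /has_cderivP df /has_cderivP dg; apply/has_cderivP; exact: is_deriveM. Qed.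

Lemma has_cderivZ a f z d : has_cderiv f z d ->
  has_cderiv (fun w => a * f w) z (a * d).
Proof.
move=> fd; have := has_cderivM (has_cderiv_cst a z) fd.
by rewrite mulr0 addr0.
Qed.

Lemma has_cderiv_sum n (f : 'I_n -> C -> C) z (d : 'I_n -> C) :
  (forall i, has_cderiv (f i) z (d i)) ->
  has_cderiv (fun w => \sum_i f i w) z (\sum_i d i).
Proof.
elim: n f d => [|n ih] f d fd.
  rewrite big_ord0 (_ : (fun w => _) = fun=> 0); first exact: has_cderiv_cst.
  by apply/funext => w; rewrite big_ord0.
rewrite big_ord_recl (_ : (fun w => _) =
    fun w => f ord0 w + \sum_i f (lift ord0 i) w).
  by apply: has_cderivD => //; exact: ih.
by apply/funext => w; rewrite big_ord_recl.
Qed.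

Lemma has_cderivV f z d : f z != 0 -> has_cderiv f z d ->
  has_cderiv (fun w => (f w)^-1) z (- (f z) ^- 2 * d).
Proof.
move=> fz /has_cderivP[df <-]; apply/has_cderivP; apply: DeriveDef.
  exact: derivableV.
exact: deriveV.
Qed.

Lemma has_cderiv_ext f g z d d' :
  has_cderiv f z d -> f = g -> d = d' -> has_cderiv g z d'.
Proof. by move=> ? <- <-. Qed.

Lemma has_cderiv_continuous f z d : has_cderiv f z d -> {for z, continuous f}.
Proof.
by move=> /has_cderivP[/derivable1_diffP df _]; exact: differentiable_continuous.
Qed.

Lemma has_cderiv_unique f z d d' :
  has_cderiv f z d -> has_cderiv f z d' -> d = d'.
Proof. by move=> /has_cderivP[_ <-] /has_cderivP[_ <-]. Qed.

Lemma has_cderiv_near f g z d (r : C) : 0 < r ->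
  (forall w, `|w - z| < r -> f w = g w) -> has_cderiv f z d -> has_cderiv g z d.
Proof.
move=> r0 fg fd e e0; have [s s0 hs] := fd e e0.
have rs : (r >=< s)%O by apply: real_comparable; exact: gtr0_real.
exists (Num.min r s) => [|w]; first by rewrite comparable_lt_min // r0.
rewrite comparable_lt_min // => /andP[wr ws].
by rewrite -!fg ?subrr ?normr0 //; exact: hs.
Qed.

Lemma has_cderiv_coord m n (w : C -> 'M[C]_(m, n)) z i j :
  differentiable w z -> has_cderiv (fun u => w u i j) z ('d w z 1 i j).
Proof.
move=> dw; apply/has_cderivP.
have @c : {linear 'M[C]_(m, n) -> C}.
  by exists (fun N : 'M[C]_(_, _) => N i j); do 2![eexists]; do ?[constructor];
     rewrite ?mxE// => ? *; rewrite ?mxE//; move=> ?; rewrite !mxE.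
have cc : continuous c by exact: coord_continuous.
have dc M : differentiable c M by exact/linear_differentiable.
rewrite (_ : (fun u => w u i j) = c \o w) //; apply: DeriveDef.
  by apply/derivable1_diffP; apply: differentiable_comp.
rewrite deriveE; last exact: differentiable_comp.
rewrite (diff_comp dw (dc _)) /comp.
have -> : 'd c (w z) = c :> (_ -> _) by exact: diff_lin.
by [].
Qed.

(** Naming the differential over an abstract field fixes the scalars: at [R[i]]
it is the [R[i]]-linear differential. *)
Definition mxdiff m n p q (F : 'M[C]_(m, n) -> 'M[C]_(p, q)) (Z Y : 'M[C]_(m, n)) :
  'M[C]_(p, q) := 'd F Z Y.

Lemma mxdiff0 m n p q (F : 'M[C]_(m, n) -> 'M[C]_(p, q)) Z : mxdiff F Z 0 = 0.
Proof. exact: linear0. Qed.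

Lemma mxdiffZ m n p q (F : 'M[C]_(m, n) -> 'M[C]_(p, q)) Z a Y :
  mxdiff F Z (a *: Y) = a *: mxdiff F Z Y.
Proof. exact: linearZ. Qed.

(** The chain rule along a curve, with the curve differentiated entry by
entry: curves are given by explicit entries below. *)
Lemma has_cderiv_mx m n p q (F : 'M[C]_(m, n) -> 'M[C]_(p, q))
    (w : C -> 'M[C]_(m, n)) z (D : 'M[C]_(m, n)) :
  differentiable F (w z) -> (forall i j, has_cderiv (fun u => w u i j) z (D i j)) ->
  forall i j, has_cderiv (fun u => F (w u) i j) z (mxdiff F (w z) D i j).
Proof.
move=> dF dw i j.
have wE : w = \sum_(i < m) (\sum_(j < n) (fun u => w u i j *: delta_mx i j)).
  apply/funext => u; rewrite fct_sumE [LHS]matrix_sum_delta.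
  by apply: eq_bigr => k _; rewrite fct_sumE.
have dij k l : differentiable (fun u => w u k l) z.
  by have /has_cderivP[/derivable1_diffP] := dw k l.
have dwz : differentiable w z.
  rewrite wE; apply: differentiable_sum => k; apply: differentiable_sum => l.
  exact: differentiableZl.
have -> : D = 'd w z 1.
  apply/matrixP => k l; apply: has_cderiv_unique (dw k l) _.
  exact: has_cderiv_coord.
have := @has_cderiv_coord _ _ (F \o w) z i j (differentiable_comp dwz dF).
by rewrite /mxdiff diff_comp.
Qed.

Lemma has_cderiv_line m n (X : 'M[C]_(m, n)) z i j :
  has_cderiv (fun u => (u *: X) i j) z (X i j).
Proof.
apply: has_cderiv_ext (has_cderivZ (X i j) (has_cderiv_id z)) _ _.
  by apply/funext => u; rewrite mxE mulrC.
by rewrite mulr1.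
Qed.

End calculus.

(** * Contractions and the domains of type I *)

(** The Hermitian form of [1 - Z Z^*] at [v] is [|v|^2 - |Z^* v|^2], so the
domain is the open unit ball of the operator norm. *)
Lemma OmegaIP (C : numClosedFieldType) r s (Z : 'M[C]_(r, s)) :
  OmegaI C r s Z <-> forall v : 'I_r -> C, (exists i, v i != 0) ->
    \sum_j `|\sum_i (Z i j)^* * v i| ^+ 2 < \sum_i `|v i| ^+ 2.
Proof.
have herm : (1%:M - Z *m Z ^t*) \is hermsymmx.
  apply/is_hermitianmxP; rewrite expr0 scale1r.
  apply/matrixP => i j; rewrite !mxE rmorphB rmorph_sum /=.
  congr (_ - _); first by rewrite conjC_nat eq_sym.
  by apply: eq_bigr => k _; rewrite !mxE rmorphM /= conjCK mulrC.
have formE (v : 'cV[C]_r) : (v ^t* *m (1%:M - Z *m Z ^t*) *m v) 0 0 =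
    \sum_i `|v i 0| ^+ 2 - \sum_j `|\sum_i (Z i j)^* * v i 0| ^+ 2.
  have sq p (u : 'cV[C]_p) : (u ^t* *m u) 0 0 = \sum_i `|u i 0| ^+ 2.
    by rewrite mxE; apply: eq_bigr => i _; rewrite !mxE normCKC.
  rewrite mulmxBr mulmxBl mulmx1 !mulmxA.
  have -> : (v ^t* *m Z *m Z ^t* *m v = (Z ^t* *m v) ^t* *m (Z ^t* *m v)).
    by rewrite trmx_mul map_mxM trmxCK !mulmxA.
  rewrite mxE [X in _ + X]mxE !sq; congr (_ - _); apply: eq_bigr => j _.
  by rewrite mxE; congr (`| _ | ^+ 2); apply: eq_bigr => i _; rewrite !mxE.
have formE' (v : 'I_r -> C) :
    ((\col_i v i) ^t* *m (1%:M - Z *m Z ^t*) *m (\col_i v i)) 0 0 =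
    \sum_i `|v i| ^+ 2 - \sum_j `|\sum_i (Z i j)^* * v i| ^+ 2.
  rewrite formE; congr (_ - _); first by apply: eq_bigr => i _; rewrite mxE.
  apply: eq_bigr => j _; congr (`| _ | ^+ 2); apply: eq_bigr => i _.
  by rewrite mxE.
split=> [[_ hZ] v [i vi] | hZ].
  rewrite -subr_gt0 -formE'; apply: hZ.
  by apply: contraNneq vi => /matrixP/(_ i 0); rewrite !mxE => ->.
split=> // v v0; rewrite formE subr_gt0; apply: (hZ (fun i => v i 0)).
apply: contrapT => v00; case/eqP: v0; apply/matrixP => i j.
rewrite ord1 mxE; apply: contrapT => vi; apply: v00.
by exists i; apply/eqP.
Qed.

Local Open Scope complex_scope.

Lemma normr_normc (R : realType) (z : R[i]) : `|z| = (normc z)%:C.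
Proof. by []. Qed.

Lemma normc_ge0 (R : realType) (z : R[i]) : 0 <= normc z.
Proof. by case: z => x y /=; rewrite sqrtr_ge0. Qed.

Lemma normr_Re_le (R : realType) (z : R[i]) : `|complex.Re z| <= normc z.
Proof.
by case: z => x y /=; rewrite -sqrtr_sqr ler_wsqrtr // lerDl sqr_ge0.
Qed.

Lemma normr_Im_le (R : realType) (z : R[i]) : `|complex.Im z| <= normc z.
Proof.
by case: z => x y /=; rewrite -sqrtr_sqr ler_wsqrtr // lerDr sqr_ge0.
Qed.

Lemma normc_ReIm_le (R : realType) (z : R[i]) :
  normc z <= `|complex.Re z| + `|complex.Im z|.
Proof.
case: z => x y /=; rewrite -[leRHS]ger0_norm ?addr_ge0 // -sqrtr_sqr.
rewrite ler_wsqrtr // sqrrD !real_normK ?num_real // addrAC lerDl.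
by rewrite mulrn_wge0 ?mulr_ge0.
Qed.

Lemma normcD (R : realType) (z w : R[i]) : normc (z + w) <= normc z + normc w.
Proof. exact: le_normcD. Qed.

(** The squared modulus with values in [R], where the order is total. *)
Definition sqn (R : realType) (z : R[i]) : R :=
  complex.Re z ^+ 2 + complex.Im z ^+ 2.

Section sqn.
Context {R : realType}.
Implicit Types z w : R[i].

Lemma sqnE z : `|z| ^+ 2 = (sqn z)%:C.
Proof. by rewrite add_Re2_Im2. Qed.

Lemma sqn_ge0 z : 0 <= sqn z.
Proof. by rewrite addr_ge0 ?sqr_ge0. Qed.

Lemma sqn0 : sqn (0 : R[i]) = 0.
Proof. by rewrite /sqn /= expr0n addr0. Qed.

Lemma sqn_eq0 z : (sqn z == 0) = (z == 0).
Proof.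
by case: z => x y; rewrite /sqn paddr_eq0 ?sqr_ge0 // !sqrf_eq0 eq_complex.
Qed.

Lemma sqn_gt0 z : (0 < sqn z) = (z != 0).
Proof. by rewrite lt0r sqn_eq0 sqn_ge0 andbT. Qed.

Lemma sqnM z w : sqn (z * w) = sqn z * sqn w.
Proof. by case: z => a b; case: w => c d; rewrite /sqn /=; ring. Qed.

Lemma sqn_real (x : R) : sqn x%:C = x ^+ 2.
Proof. by rewrite /sqn /= expr0n addr0. Qed.

Lemma sqn_conj z : sqn (conjc z) = sqn z.
Proof. by case: z => a b; rewrite /sqn /= sqrrN. Qed.

(** Lagrange's identity exhibits the difference as a squared modulus. *)
Lemma sqn_cauchy a b z w :
  sqn (a * z + b * w) <= (sqn a + sqn b) * (sqn z + sqn w).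
Proof.
have -> : (sqn a + sqn b) * (sqn z + sqn w) =
    sqn (a * z + b * w) + sqn (a * conjc w - b * conjc z).
  case: a => a1 a2; case: b => b1 b2; case: z => z1 z2; case: w => w1 w2.
  by rewrite /sqn /=; ring.
by rewrite lerDl sqn_ge0.
Qed.

Lemma OmegaI_sqn r s (Z : 'M[R[i]]_(r, s)) :
  OmegaI R[i] r s Z <-> forall v : 'I_r -> R[i], (exists i, v i != 0) ->
    \sum_j sqn (\sum_i conjc (Z i j) * v i) < \sum_i sqn (v i).
Proof.
have E (v : 'I_r -> R[i]) :
    (\sum_j `|\sum_i (Z i j)^*%R * v i| ^+ 2 < \sum_i `|v i| ^+ 2) =
    (\sum_j sqn (\sum_i conjc (Z i j) * v i) < \sum_i sqn (v i)).
  rewrite -ltcR !rmorph_sum /=.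
  by congr (_ < _); apply: eq_bigr => i _; rewrite sqnE.
split=> [/OmegaIP hZ v v0 | hZ]; first by rewrite -E; exact: hZ.
by apply/OmegaIP => v v0; rewrite E; exact: hZ.
Qed.

End sqn.

(** The closure of the domain: operator norm at most [1]. *)
Definition contraction (R : realType) r s (Z : 'M[R[i]]_(r, s)) : Prop :=
  forall v : 'I_r -> R[i],
    \sum_j sqn (\sum_i conjc (Z i j) * v i) <= \sum_i sqn (v i).

Section contraction.
Context {R : realType}.

Lemma mulJ (z : R[i]) : z * conjc z = (sqn z)%:C.
Proof.
by case: z => a b; apply/eqP; rewrite eq_complex /sqn /=; apply/andP; split;
  apply/eqP; ring.
Qed.

Lemma normrMJ_le (z w : R[i]) : `|z * conjc w| <= ((sqn w + sqn z) / 2)%:C.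
Proof.
have sq (x : R[i]) : normc x ^+ 2 = sqn x.
  by apply: complexI; rewrite rmorphXn /= -sqnE.
rewrite normr_normc lecR normcM -(sqn_conj w) -!sq.
move: (normc z) (normc (conjc w)) => a b.
by have := sqr_ge0 (a - b); rewrite sqrrB; lra.
Qed.

Lemma scaled_contraction r s (X : 'M[R[i]]_(r, s)) (z : R[i]) :
  contraction X -> `|z| < 1 -> OmegaI R[i] r s (z *: X).
Proof.
move=> cX z1; apply/OmegaI_sqn => v [i0 vi0].
have sz : sqn z < 1.
  by rewrite -ltcR -sqnE; apply: exprn_ilt1.
have v0 : 0 < \sum_i sqn (v i).
  rewrite (bigD1 i0) //= ltr_pwDl ?sqn_gt0 //.
  by apply: sumr_ge0 => i _; exact: sqn_ge0.
have -> : \sum_j sqn (\sum_i conjc ((z *: X) i j) * v i) =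
    sqn z * \sum_j sqn (\sum_i conjc (X i j) * v i).
  rewrite mulr_sumr; apply: eq_bigr => j _.
  rewrite -[sqn z]sqn_conj -sqnM mulr_sumr; congr sqn; apply: eq_bigr => i _.
  by rewrite mxE mulrA; congr (_ * _); exact: rmorphM.
apply: (@le_lt_trans _ _ (sqn z * \sum_i sqn (v i))).
  by rewrite ler_wpM2l ?sqn_ge0.
by rewrite gtr_pMl.
Qed.

End contraction.

Lemma contraction_row (R : realType) r s (Z : 'M[R[i]]_(r, s)) i :
  contraction Z -> \sum_j sqn (Z i j) <= 1.
Proof.
move=> cZ; have := cZ (fun k => if k == i then 1 else 0).
have s1 : sqn (1 : R[i]) = 1 by rewrite /sqn /= expr0n addr0 expr1n.
have -> : \sum_(k < r) sqn (if k == i then 1 else 0 : R[i]) = 1.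
  by rewrite (bigD1 i) //= eqxx s1 big1 ?addr0 // => k /negbTE ->; rewrite sqn0.
congr (_ <= _); apply: eq_bigr => j _.
rewrite (bigD1 i) //= eqxx mulr1 big1 ?addr0 ?sqn_conj // => k nk.
by rewrite (negbTE nk) mulr0.
Qed.

(** The definition controls [Z^*], hence the rows; for a column, testing on the
column itself shows that its squared norm [N] satisfies [N ^+ 2 <= N]. *)
Lemma contraction_col (R : realType) r s (Z : 'M[R[i]]_(r, s)) j :
  contraction Z -> \sum_i sqn (Z i j) <= 1.
Proof.
move=> cZ; have := cZ (fun i => Z i j); rewrite /=; set N := \sum_i sqn (Z i j) => cN.
have N0 : 0 <= N by apply: sumr_ge0 => i _; exact: sqn_ge0.
have : N ^+ 2 <= N.
  apply: le_trans cN; rewrite (bigD1 j) //= -[leLHS]addr0 lerD //; last first.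
    by apply: sumr_ge0 => k _; exact: sqn_ge0.
  under eq_bigr do rewrite mulrC mulJ.
  by rewrite -rmorph_sum sqn_real.
have [->|Nn] := eqVneq N 0; first by rewrite ler01 //.
by rewrite expr2 ger_pMr // lt_def Nn.
Qed.

Lemma contraction_delta (R : realType) r s (i0 : 'I_r) (j0 : 'I_s) :
  contraction (delta_mx i0 j0 : 'M[R[i]]_(r, s)).
Proof.
move=> v; rewrite (bigD1 j0) //= [leRHS](bigD1 i0) //= lerD //.
  rewrite (bigD1 i0) //= big1 => [|i ni]; last first.
    by rewrite mxE conjc_nat (negbTE ni) mul0r.
  by rewrite mxE conjc_nat !eqxx mul1r addr0.
rewrite big1 => [|j nj]; first by apply: sumr_ge0 => i _; exact: sqn_ge0.
rewrite big1 ?sqn0 // => i _.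
by rewrite mxE conjc_nat (negbTE nj) andbF mul0r.
Qed.

(** * The Schwarz lemma on the disc *)

Lemma has_cderiv_normc (R : realType) (f : R[i] -> R[i]) (z d : R[i]) :
  has_cderiv f z d -> forall e : R, 0 < e -> exists2 r : R, 0 < r &
    forall w, normc (w - z) < r ->
      normc (f w - f z - d * (w - z)) <= e * normc (w - z).
Proof.
move=> fd e e0; have [|r r0 hr] := fd e%:C; first by rewrite ltcR.
exists (complex.Re r) => [|w wr]; first by move: r0; rewrite ltcE => /andP[].
rewrite -lecR rmorphM /= -!normr_normc; apply: hr.
by move: r0; rewrite normr_normc !ltcE /= => /andP[/eqP-> _]; rewrite eqxx.
Qed.

Definition cexp (R : realType) (x y : R) : R[i] :=
  (expR x * cos y) +i* (expR x * sin y).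

Lemma cexpD (R : realType) (x y a b : R) :
  cexp (x + a) (y + b) = cexp x y * cexp a b.
Proof.
by apply/eqP; rewrite eq_complex /= expRD cosD sinD; apply/andP; split;
  apply/eqP; ring.
Qed.

Lemma normc_cexp (R : realType) (x y : R) : normc (cexp x y) = expR x.
Proof.
rewrite /= !exprMn -mulrDr cos2Dsin2 mulr1 sqrtr_sqr ger0_norm ?expR_ge0 //.
Qed.

Lemma cexp_approx (R : realType) (e : R) : 0 < e -> exists2 d, 0 < d &
  forall a b, `|a| < d -> `|b| < d ->
    normc (cexp a b - 1 - (a +i* b)) <= e * (`|a| + `|b|).
Proof.
move=> e0.
have de : has_cderiv (@expR R) 0 1.
  by apply/has_cderivP; have := is_derive_expR (0 : R); rewrite expR0.
have ds : has_cderiv (@sin R) 0 1.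
  by apply/has_cderivP; have := is_derive_sin (0 : R); rewrite cos0.
have dc : has_cderiv (@cos R) 0 0.
  apply/has_cderivP.
  by have := is_derive_cos (0 : R); rewrite sin0 oppr0.
(* The two components add up to at most [f * `|a| + 5 * f * `|b|]. *)
pose f := Num.min (e / 6) 1.
have f0 : 0 < f by rewrite lt_min ltr01 divr_gt0.
have fe : f <= e / 6 by rewrite ge_min lexx.
have f1 : f <= 1 by rewrite ge_min lexx orbT.
have [r1 r10 h1] := de f f0; have [r2 r20 h2] := ds f f0.
have [r3 r30 h3] := dc f f0.
exists (Num.min (Num.min r1 r2) (Num.min r3 (f / 2))).
  by rewrite !lt_min r10 r20 r30 divr_gt0.
move=> a b; rewrite !lt_min => /andP[/andP[a1 _] /andP[_ af]].
move=> /andP[/andP[_ b2] /andP[b3 bf]].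
have := h1 a; have := h2 b; have := h3 b.
rewrite !subr0 expR0 cos0 sin0 !mul1r !mul0r !subr0.
move=> /(_ b3) c3 /(_ b2) c2 /(_ a1) c1.
apply: le_trans (normc_ReIm_le _) _ => /=; rewrite subr0.
have ef : `|expR a - 1| <= f.
  have -> : expR a - 1 = (expR a - 1 - a) + a by ring.
  apply: le_trans (ler_normD _ _) _.
  have : f * `|a| <= 1 * `|a| by rewrite ler_wpM2r.
  by lra.
have e2 : `|expR a| <= 2.
  by rewrite ger0_norm ?expR_ge0 //; move: ef; rewrite ler_norml => /andP[]; lra.
have -> : expR a * cos b - 1 - a = expR a * (cos b - 1) + (expR a - 1 - a) by ring.
have -> : expR a * sin b - b = expR a * (sin b - b) + (expR a - 1) * b by ring.
apply: le_trans (lerD (ler_normD _ _) (ler_normD _ _)) _.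
rewrite !normrM.
have p1 : `|expR a| * `|cos b - 1| <= 2 * (f * `|b|) by apply: ler_pM.
have p2 : `|expR a| * `|sin b - b| <= 2 * (f * `|b|) by apply: ler_pM.
have p3 : `|expR a - 1| * `|b| <= f * `|b| by apply: ler_wpM2r.
have p4 : f * `|b| <= e / 6 * `|b| by apply: ler_wpM2r.
have p5 : f * `|a| <= e / 6 * `|a| by apply: ler_wpM2r.
have p6 : 0 <= e / 6 * `|a| by rewrite mulr_ge0 // divr_ge0 // ltW.
have p7 : 0 <= e / 6 * `|b| by rewrite mulr_ge0 // divr_ge0 // ltW.
by lra.
Qed.

(** The function [f \o cexp] is complex differentiable in the variable
[x + i y], by the chain rule written with remainders. *)
Lemma log_coordinates_approx (R : realType) (f : R[i] -> R[i]) (d : R[i])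
    (x y : R) : x < 0 -> has_cderiv f (cexp x y) d ->
  forall e, 0 < e -> exists2 r, 0 < r & forall x' y',
    `|x' - x| < r -> `|y' - y| < r ->
    normc (f (cexp x' y') - f (cexp x y)
           - d * cexp x y * ((x' - x) +i* (y' - y)))
      <= e * (`|x' - x| + `|y' - y|).
Proof.
move=> x0 fd e e0.
have nd0 : 0 <= normc d := normc_ge0 d.
(* [e1] bounds the remainder of the exponential: it is multiplied by [d], and
   [e1 <= 1] keeps the increment of the exponential below [2 * n]. *)
pose e1 := Num.min (e / 2 / (normc d + 1)) 1.
have e10 : 0 < e1 by rewrite lt_min ltr01 !divr_gt0 // ltr_wpDl.
have e1d : normc d * e1 <= e / 2.
  apply: le_trans (_ : (normc d + 1) * e1 <= _).
    by rewrite ler_wpM2r // ?(ltW e10) // lerDl.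
  by rewrite -ler_pdivlMl ?ltr_wpDl // mulrC ge_min lexx.
have e11 : e1 <= 1 by rewrite ge_min lexx orbT.
have [r r0 hr] := has_cderiv_normc fd (divr_gt0 e0 (ltr0n _ 4) : 0 < e / 4).
have [s s0 hs] := cexp_approx e10.
exists (Num.min s (r / 4)) => [|x' y']; first by rewrite lt_min s0 divr_gt0.
rewrite !lt_min => /andP[xs xr] /andP[ys yr].
have := hs _ _ xs ys; set a := x' - x; set b := y' - y.
set n := `|a| + `|b|; set E := cexp a b => En.
have nn0 : 0 <= n by rewrite addr_ge0.
have ex1 : normc (cexp x y) <= 1 by rewrite normc_cexp -expR0 ler_expR ltW.
have nE0 : 0 <= normc (cexp x y) := normc_ge0 _.
have cle v : normc (cexp x y * v) <= normc v.
  by rewrite normcM ler_piMl // normc_ge0.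
have -> : cexp x' y' = cexp x y * E by rewrite -cexpD ![_ + a]addrC ![_ + b]addrC !subrK.
have E2 : normc (cexp x y * E - cexp x y) <= 2 * n.
  have -> : cexp x y * E - cexp x y =
     cexp x y * ((E - 1 - (a +i* b)) + (a +i* b)) by ring.
  apply: le_trans (cle _) _.
  apply: le_trans (normcD _ _) _.
  have h2 : normc (a +i* b) <= n := normc_ReIm_le _.
  have h3 : e1 * n <= 1 * n by rewrite ler_wpM2r.
  by lra.
have E3 : normc (cexp x y * E - cexp x y - cexp x y * (a +i* b)) <= e1 * n.
  have -> : cexp x y * E - cexp x y - cexp x y * (a +i* b) =
     cexp x y * (E - 1 - (a +i* b)) by ring.
  apply: le_trans (cle _) _.
  by [].
have -> : f (cexp x y * E) - f (cexp x y) - d * cexp x y * (a +i* b) =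
  (f (cexp x y * E) - f (cexp x y) - d * (cexp x y * E - cexp x y)) +
  d * (cexp x y * E - cexp x y - cexp x y * (a +i* b)) by ring.
apply: le_trans (normcD _ _) _; rewrite normcM.
have h4 : normc (cexp x y * E - cexp x y) < r.
  by apply: le_lt_trans E2 _; rewrite /n; lra.
have := hr _ h4 => h5.
have h6 : e / 4 * normc (cexp x y * E - cexp x y) <= e / 4 * (2 * n).
  by rewrite ler_wpM2l // divr_ge0 // ltW.
have h7 : normc d * normc (cexp x y * E - cexp x y - cexp x y * (a +i* b)) <=
   normc d * (e1 * n) by rewrite ler_wpM2l.
have h8 : normc d * (e1 * n) <= e / 2 * n by rewrite mulrA ler_wpM2r.
by lra.
Qed.

(** A maximum principle across an isolated singularity: [c] bounds from below
the limit of the real part at the centre, [m] is a bound on a circle.  The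
vertical sides of the rectangle [[a, b] x [0, 2 pi]] in the logarithmic
coordinate are the circles of radii [expR a] and [expR b]; by [goursat] the real
part has the same mean on both. *)
Lemma punctured_disc_Re_le (R : realType) (f : R[i] -> R[i]) (b c m : R) :
  b < 0 ->
  (forall z, 0 < normc z < 1 -> exists d, has_cderiv f z d) ->
  (forall e, 0 < e -> exists2 r, 0 < r &
     forall z, 0 < normc z < r -> c - e <= complex.Re (f z)) ->
  (forall z, normc z = expR b -> complex.Re (f z) <= m) ->
  c <= m.
Proof.
move=> b0 df fc fm; apply/ler_addgt0Pr => e e0.
have [r r0 hr] := fc e e0.
(* The circle of radius [expR a] lies in the disc where [hr] applies. *)
pose a := Num.min (ln r) b - 1.
have ab : a < b by rewrite /a ltrBlDr gt_min [in X in _ || X]ltrDl ltr01 orbT.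
have ar : expR a < r.
  rewrite -[ltRHS]lnK ?posrE // ltr_expR /a ltrBlDr gt_min.
  by rewrite ltrDl ltr01.
have cexp1 (x y : R) : x < 0 -> 0 < normc (cexp x y) < 1.
  by move=> x0; rewrite normc_cexp expR_gt0 -expR0 ltr_expR.
have approx x y : x < 0 -> exists D : R[i], forall e, 0 < e ->
    exists2 r, 0 < r & forall x' y', `|x' - x| < r -> `|y' - y| < r ->
    normc (f (cexp x' y') - f (cexp x y) - D * ((x' - x) +i* (y' - y)))
      <= e * (`|x' - x| + `|y' - y|).
  move=> x0; have [d fd] := df _ (cexp1 x y x0).
  by exists (d * cexp x y) => e' e'0; apply: log_coordinates_approx.
pose P x y := complex.Im (f (cexp x y)).
pose Q x y := complex.Re (f (cexp x y)).
(* The Cauchy-Riemann equations, for the form [P dx + Q dy] which is the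
   imaginary part of [f (exp u) du]. *)
have expansion x y : x < 0 -> exists p q : R, forall e, 0 < e ->
    exists2 r, 0 < r & forall x' y', `|x' - x| < r -> `|y' - y| < r ->
    `|P x' y' - (P x y + q * (x' - x) + p * (y' - y))|
      <= e * (`|x' - x| + `|y' - y|) /\
    `|Q x' y' - (Q x y + p * (x' - x) + - q * (y' - y))|
      <= e * (`|x' - x| + `|y' - y|).
  move=> /approx-/(_ y)[[p q] hD]; exists p, q => e' /hD[s s0 hs]; exists s => //.
  move=> x' y' hx hy; have := hs x' y' hx hy; rewrite /P /Q.
  case: (f (cexp x' y')) => u v; case: (f (cexp x y)) => u0 v0 h.
  have hR := le_trans (normr_Re_le _) h; have hI := le_trans (normr_Im_le _) h.
  split.
    by move: hI => /=; congr (`| _ | <= _); ring.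
  by move: hR => /=; congr (`| _ | <= _); ring.
have contP y x : x < 0 -> {for x, continuous (fun x => P x y)}.
  move=> x0; have [p [q hpq]] := expansion x y x0.
  apply: (@has_cderiv_continuous _ _ _ q) => e' /hpq[s s0 hs].
  exists s => // x' xs; have [] := hs x' y xs; first by rewrite subrr normr0.
  by rewrite !subrr normr0 mulr0 !addr0 opprD addrA.
have contQ x y : x < 0 -> {for y, continuous (fun y => Q x y)}.
  move=> x0; have [p [q hpq]] := expansion x y x0.
  apply: (@has_cderiv_continuous _ _ _ (- q)) => e' /hpq[s s0 hs].
  exists s => // y' ys; have [|_] := hs x y' _ ys; first by rewrite subrr normr0.
  by rewrite !subrr normr0 mulr0 addr0 add0r opprD addrA.
have T0 : 0 < pi *+ 2 :> R by rewrite pmulrn_lgt0 // pi_gt0.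
have prim_ex (u v : R) : u < v -> exists prim : (R -> R) -> R -> R, forall g,
    (forall x : R, u <= x <= v -> {for x, continuous g}) ->
    forall x : R, u < x < v -> is_derive x 1 (prim g) (g x).
  move=> uv; suff ex g : exists F : R -> R,
      (forall x : R, u <= x <= v -> {for x, continuous g}) ->
      forall x : R, u < x < v -> is_derive x 1 F (g x).
    by exists (fun g => sval (cid (ex g))) => g; case: cid.
  have [cg|n] := pselect (forall x : R, u <= x <= v -> {for x, continuous g});
    last by exists g.
  by have [F hF] := continuous_primitive uv cg; exists F.
have [|primx primxP] := prim_ex (a - 1) (b / 2); first by lra.
have [|primy primyP] := prim_ex (- 1) (pi *+ 2 + 1); first by lra.
pose G y := primx (fun x => P x y).
pose K x := primy (fun y => Q x y).
have dG (x y : R) : a <= x <= b -> is_derive x 1 (G y) (P x y).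
  by move=> xab; apply: (primxP (fun x => P x y)) => [x' x'ab|];
    [apply: contP; lra | lra].
have dK (x y : R) : a <= x <= b -> 0 <= y <= pi *+ 2 -> is_derive y 1 (K x) (Q x y).
  by move=> xab yab; apply: (primyP (fun y => Q x y)) => [y' y'ab|];
    [apply: contQ; lra | lra].
(* The horizontal sides cancel: both carry the same function, by periodicity. *)
have GT : G (0 + pi *+ 2) = G 0.
  congr primx; apply/funext => x.
  by rewrite /P /cexp cosD2pi sinD2pi.
have := @goursat R P Q G K a 0 (b - a) (pi *+ 2).
rewrite /circulation GT (addrC a) subrK add0r => /(_ _ _ _ _ _).
have -> : forall u v w : R, u + v - u - w = v - w by move=> u v w; ring.
move=> gou; have {gou} KE : K b (pi *+ 2) - K b 0 = K a (pi *+ 2) - K a 0.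
  apply/eqP; rewrite -subr_eq0; apply/eqP; apply: gou; rewrite ?ltW ?subr_gt0 //.
  - by move=> p q hp _; apply: dG; lra.
  - move=> x y xab _; have [|p [q hpq]] := expansion x y; first by lra.
    exists q, p, (- q) => e' /hpq[s s0 hs]; exists s => // x' y' _ _.
    exact: hs.
have up : K b (pi *+ 2) - K b 0 <= m * (pi *+ 2).
  have := @increment_le R (K b) (Q b) 0 (pi *+ 2) m (ltW T0); rewrite add0r.
  apply=> y hy; first by apply: dK => //; lra.
  by apply: fm; rewrite normc_cexp.
have dn : - K a (pi *+ 2) - - K a 0 <= (e - c) * (pi *+ 2).
  have := @increment_le R (fun y => - K a y) (fun y => - Q a y) 0 (pi *+ 2)
    (e - c) (ltW T0); rewrite add0r.
  apply=> y hy; first by apply: is_deriveN; apply: dK => //; lra.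
  have := hr (cexp a y); rewrite normc_cexp expR_gt0 ar => /(_ isT).
  by rewrite -/(Q a y); lra.
rewrite -(ler_pM2r T0); lra.
Qed.

(** Apply the previous lemma to [f z / z], on circles whose radius tends to
[1].  Bounding the real part suffices below, since the derivatives in question
are nonnegative real numbers. *)
Lemma schwarz_Re (R : realType) (f : R[i] -> R[i]) (d : R[i]) (m : R) :
  (forall z : R[i], `|z| < 1 -> exists d, has_cderiv f z d) ->
  f 0 = 0 -> has_cderiv f 0 d ->
  (forall z : R[i], `|z| < 1 -> `|f z| <= m%:C) ->
  complex.Re d <= m.
Proof.
move=> df f0 fd fm.
have fm' (z : R[i]) : normc z < 1 -> normc (f z) <= m.
  by move=> z1; rewrite -lecR; apply: fm; rewrite -ltcR in z1.
have m0 : 0 <= m by apply: le_trans (fm' 0 _); rewrite ?normc_ge0 // normc0.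
apply/ler_addgt0Pr => e e0.
(* The radius [expR b] is chosen so that [m / expR b <= m + e]. *)
pose b := - ln (1 + e / (m + 1)).
have e'0 : 0 < e / (m + 1) by rewrite divr_gt0 // ltr_wpDl.
have b0 : b < 0 by rewrite oppr_lt0 ln_gt0 // ltrDl.
apply: (@punctured_disc_Re_le R (fun z => f z / z) b) => //.
- move=> z /andP[z0 z1].
  have [d' fd'] : exists d', has_cderiv f z d' by apply: df; rewrite normr_normc ltcR.
  have zn0 : z != 0 by apply: contraTneq z0 => ->; rewrite normc0 ltxx.
  have := has_cderivM fd' (has_cderivV (f := id) zn0 (has_cderiv_id z)).
  by exists (f z * (- z ^- 2 * 1) + z^-1 * d').
- move=> e1 e10; have [r r0 hr] := has_cderiv_normc fd e10.
  exists r => // z /andP[z0 zr].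
  have := hr z; rewrite subr0 f0 subr0 => /(_ zr).
  have zn0 : z != 0 by apply: contraTneq z0 => ->; rewrite normc0 ltxx.
  have -> : f z - d * z = (f z / z - d) * z by field.
  rewrite normcM ler_pM2r // => h.
  have := le_trans (normr_Re_le _) h.
  case: (f z / z) => u v; case: (d) => u0 v0 /=.
  by rewrite ler_norml => /andP[+ _]; lra.
- move=> z zb; apply: le_trans (ler_norm _) _; apply: le_trans (normr_Re_le _) _.
  rewrite normcM normcV zb expRN invrK lnK ?posrE ?addr_gt0 //.
  have fz : normc (f z) <= m by apply: fm'; rewrite zb -expR0 ltr_expR.
  apply: le_trans (_ : m * (1 + e / (m + 1)) <= _).
    by rewrite ler_wpM2r // ltW // addr_gt0.
  rewrite mulrDr mulr1 lerD2l mulrCA ger_pMr //.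
  by rewrite ler_pdivrMr ?ltr_wpDl // mul1r lerDl.
Qed.

(** * The Schwarz lemma on the domains of type I *)

(** Reduction to the disc.  For [Y] the differential applied to [X] and
[u = Y^* v], the holomorphic function [z |-> < F (z X)^* v, u >] has derivative
[|u|^2] at [0], and the arithmetic-geometric inequality bounds it by
[(|v|^2 + |u|^2) / 2] on the disc because [F (z X)] is in the unit ball.  So
[|u|^2 <= (|v|^2 + |u|^2) / 2], that is, [|Y^* v| <= |v|]. *)
Lemma schwarz_contraction (R : realType) m n p q (F : 'M[R[i]]_(m, n) -> 'M[R[i]]_(p, q))
    (X : 'M[R[i]]_(m, n)) :
  set_fun (OmegaI R[i] m n) (OmegaI R[i] p q) F ->
  holomorphic_on (OmegaI R[i] m n) F -> F 0 = 0 ->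
  contraction X -> contraction (mxdiff F 0 X).
Proof.
move=> FO dF F0 cX v; set Y := mxdiff F 0 X.
pose u j := \sum_i conjc (Y i j) * v i.
set N := \sum_j sqn _; set V := \sum_i sqn _.
pose w (z : R[i]) : 'M[R[i]]_(m, n) := z *: X.
pose f (z : R[i]) := \sum_(j < q) \sum_(i < p) conjc (v i) * u j * F (w z) i j.
have inO (z : R[i]) : `|z| < 1 -> OmegaI R[i] m n (w z).
  exact: scaled_contraction.
have fd (z : R[i]) : `|z| < 1 -> has_cderiv f z
    (\sum_(j < q) \sum_(i < p) conjc (v i) * u j * mxdiff F (w z) X i j).
  move=> z1.
  have dFw i j : has_cderiv (fun u => F (w u) i j) z (mxdiff F (w z) X i j).
    apply: has_cderiv_mx; first exact: (dF _ (inO z z1)).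
    by move=> k l; exact: has_cderiv_line.
  apply: has_cderiv_sum => j; apply: has_cderiv_sum => i.
  exact: has_cderivZ.
suff : N <= (V + N) / 2 by lra.
have pairing (G : 'M[R[i]]_(p, q)) :
    \sum_(j < q) \sum_(i < p) conjc (v i) * u j * G i j =
    \sum_j u j * conjc (\sum_i conjc (G i j) * v i).
  apply: eq_bigr => j _; rewrite (rmorph_sum (@conjc R)) mulr_sumr.
  apply: eq_bigr => i _; rewrite (rmorphM (@conjc R)) /= conjcK; ring.
have NE : complex.Re (\sum_(j < q) \sum_(i < p) conjc (v i) * u j * Y i j) = N.
  rewrite pairing; under eq_bigr do rewrite mulJ.
  by rewrite -rmorph_sum.
rewrite -[leLHS]NE; apply: (@schwarz_Re R f) => //.
- by move=> z /fd; exists (\sum_(j < q) \sum_(i < p) conjc (v i) * u j * mxdiff F (w z) X i j).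
- rewrite /f /w scale0r F0; apply: big1 => j _; apply: big1 => i _.
  by rewrite mxE mulr0.
- by have := fd 0; rewrite normr0 /w scale0r => /(_ ltr01).
- move=> z /inO zO; rewrite /f pairing; apply: le_trans (ler_norm_sum _ _ _) _.
  apply: (@le_trans _ _ (\sum_j ((sqn (\sum_i conjc (F (w z) i j) * v i)
      + sqn (u j)) / 2)%:C)).
    by apply: ler_sum => j _; exact: normrMJ_le.
  rewrite -rmorph_sum lecR -mulr_suml ler_pM2r ?invr_gt0 // big_split /= lerD2r.
  have [v0|v0] := pselect (exists i, v i != 0).
    by have /OmegaI_sqn/(_ v v0)/ltW := FO _ zO.
  have v00 i : v i = 0.
    by apply: contrapT => vi; apply: v0; exists i; apply/eqP.
  rewrite /V !big1 // => [i _|j _]; first by rewrite v00 sqn0.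
  by rewrite big1 ?sqn0 // => i _; rewrite v00 mulr0.
Qed.

(** * The maps f_t are maps between the domains *)

Lemma sum2 (V : nmodType) (F : 'I_2 -> V) : \sum_i F i = F 0 + F 1.
Proof.
by rewrite !big_ord_recl big_ord0 addr0; congr (F _ + F _); apply: val_inj.
Qed.

Local Notation o4_0 := (@Ordinal 4 0 isT).
Local Notation o4_1 := (@Ordinal 4 1 isT).
Local Notation o4_2 := (@Ordinal 4 2 isT).
Local Notation o4_3 := (@Ordinal 4 3 isT).

Lemma sum4 (V : nmodType) (F : 'I_4 -> V) :
  \sum_i F i = F o4_0 + F o4_1
    + F o4_2 + F o4_3.
Proof.
rewrite !big_ord_recl big_ord0 addr0 !addrA.
by congr (F _ + F _ + F _ + F _); apply: val_inj.
Qed.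

Lemma ord4_cases (P : 'I_4 -> Prop) : P o4_0 ->
  P o4_1 -> P o4_2 -> P o4_3 ->
  forall i, P i.
Proof.
move=> P0 P1 P2 P3 [[|[|[|[|k]]]] ki] //;
  [move: P0|move: P1|move: P2|move: P3]; congr P; exact: val_inj.
Qed.

(** A product of contractions that turns out to be [f_ t] (see [f_self_map]).
Let [W] be the matrix with rows [(p, q)] and [(r, u)].  The vector [v] is sent
isometrically to the pair [(v0, a v1)], [(b v1, v2)] and the scalar [v3]; [W] acts
on both pairs, giving [A0, A1, B0, B1]; the middle entries [A1], [B0], [v3] are
mixed by a contraction into [x], [y] and a scalar; [W] acts again on [(A0, x)] and
[(y, B1)], and the adjoint of the first isometry concludes.  If the norm does not
decrease, equality at each action of [W] forces its arguments to vanish, hence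
[v = 0]. *)
Lemma two_stage_contraction (R : realType) (p q r u : R[i]) (a b c d : R)
    (v0 v1 v2 v3 : R[i]) :
  (forall x y, sqn x + sqn y != 0 ->
     sqn (p * x + q * y) + sqn (r * x + u * y) < sqn x + sqn y) ->
  a ^+ 2 + b ^+ 2 = 1 -> c ^+ 2 + d ^+ 2 = 1 -> a != 0 ->
  sqn v0 + sqn v1 + sqn v2 + sqn v3 != 0 ->
  let A0 := p * v0 + q * (a%:C * v1) in let A1 := r * v0 + u * (a%:C * v1) in
  let B0 := p * (b%:C * v1) + q * v2 in let B1 := r * (b%:C * v1) + u * v2 in
  let x := c%:C * B0 + d%:C * v3 in let y := c%:C * A1 in
  (sqn (p * A0 + q * x) + sqn (a%:C * (r * A0 + u * x) + b%:C * (p * y + q * B1))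
    + sqn (r * y + u * B1) + sqn (d%:C * A1)
  < sqn v0 + sqn v1 + sqn v2 + sqn v3 : Prop).
Proof.
move=> contr ab cd a0 v_neq0 A0 A1 B0 B1 x y.
have H (s t : R[i]) : sqn (p * s + q * t) + sqn (r * s + u * t) <= sqn s + sqn t.
  have [/eqP st|/contr/ltW //] := eqVneq (sqn s + sqn t) 0.
  move: st; rewrite paddr_eq0 ?sqn_ge0 // !sqn_eq0 => /andP[/eqP-> /eqP->].
  by rewrite !mulr0 addr0 sqn0.
have H0 s t : sqn s + sqn t <= sqn (p * s + q * t) + sqn (r * s + u * t) ->
    s = 0 /\ t = 0.
  move=> st; have : sqn s + sqn t == 0 by apply: contraLR st => /contr; rewrite -ltNge.
  by rewrite paddr_eq0 ?sqn_ge0 // !sqn_eq0 => /andP[/eqP-> /eqP->].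
have [//|ge] := ltP (sqn (p * A0 + q * x)
    + sqn (a%:C * (r * A0 + u * x) + b%:C * (p * y + q * B1))
    + sqn (r * y + u * B1) + sqn (d%:C * A1)) (sqn v0 + sqn v1 + sqn v2 + sqn v3).
have mix (e f : R) (s t : R[i]) : e ^+ 2 + f ^+ 2 = 1 -> sqn (e%:C * s + f%:C * t) <= sqn s + sqn t.
  by move=> ef; have := sqn_cauchy e%:C f%:C s t; rewrite !sqn_real ef mul1r.
have split1 e f (s : R[i]) : e ^+ 2 + f ^+ 2 = 1 -> sqn (e%:C * s) + sqn (f%:C * s) = sqn s.
  by move=> ef; rewrite !sqnM !sqn_real -mulrDl ef mul1r.
have i1 := mix a b (r * A0 + u * x) (p * y + q * B1) ab.
have i2 := H A0 x; have i3 := H y B1.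
have i4 : sqn x <= sqn B0 + sqn v3 by exact: mix.
have i5 : sqn y + sqn (d%:C * A1) = sqn A1 by exact: split1.
have i6 : sqn A0 + sqn A1 <= sqn v0 + sqn (a%:C * v1) by exact: H.
have i7 : sqn B0 + sqn B1 <= sqn (b%:C * v1) + sqn v2 by exact: H.
have i8 : sqn (a%:C * v1) + sqn (b%:C * v1) = sqn v1 by exact: split1.
have [|v00 av1] := H0 v0 (a%:C * v1); first by rewrite -/A0 -/A1; lra.
have [|bv1 v20] := H0 (b%:C * v1) v2; first by rewrite -/B0 -/B1; lra.
have [|A00 x0] := H0 A0 x; first by lra.
have A10 : A1 = 0 by rewrite /A1 v00 av1 !mulr0 addr0.
have B10 : B1 = 0 by rewrite /B1 v20 bv1 !mulr0 addr0.
have y0 : y = 0 by rewrite /y A10 mulr0.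
have v10 : v1 = 0.
  by apply/eqP; move/eqP: av1; rewrite mulf_eq0 -[0]/(0%:C) (inj_eq (@complexI R)) (negbTE a0).
case/negP: v_neq0; rewrite eq_le; apply/andP; split.
  by move: ge; rewrite A00 x0 y0 A10 B10 !(mulr0, addr0, sqn0).
have := sqn_ge0 v0; have := sqn_ge0 v1; have := sqn_ge0 v2.
by have := sqn_ge0 v3; lra.
Qed.

(** With [c = sqrt (1 - t)] and [d = sqrt t], the values
[a = 1 / sqrt (2 - t)] and [b = c / sqrt (2 - t)] make the coefficients of [f_ t]
polynomials in [a], [b], [c], [d]; they come from matching the entries of the
two-stage factorization with those of [f_ t]. *)
Lemma coefficient_identities (R : realType) (t : R) : 0 <= t <= 1 ->
  exists a b c d : R,
  [/\ a != 0, a ^+ 2 + b ^+ 2 = 1, c ^+ 2 + d ^+ 2 = 1,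
     Num.sqrt (1 - t) = c /\ Num.sqrt t = d &
   [/\ Num.sqrt (2 - t) = a + b * c,
      2 * (1 - t) / (2 - t) = 2 * a * b * c,
      2 * Num.sqrt ((1 - t) / (2 - t)) = a * c + b &
      Num.sqrt (t / (2 - t)) = a * d]].
Proof.
move=> /andP[t0 t1].
have s0 : 0 < Num.sqrt (2 - t) by rewrite sqrtr_gt0; lra.
have sE : Num.sqrt (2 - t) ^+ 2 = 2 - t by rewrite sqr_sqrtr //; lra.
have cE : Num.sqrt (1 - t) ^+ 2 = 1 - t by rewrite sqr_sqrtr //; lra.
have dE : Num.sqrt t ^+ 2 = t by rewrite sqr_sqrtr.
have sn : Num.sqrt (2 - t) != 0 by rewrite gt_eqF.
have tn : 2 - t != 0 by rewrite gt_eqF //; lra.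
have vE : Num.sqrt (2 - t)^-1 = (Num.sqrt (2 - t))^-1 by rewrite sqrtrV //; lra.
have m1 : Num.sqrt ((1 - t) / (2 - t)) = Num.sqrt (1 - t) / Num.sqrt (2 - t).
  by rewrite sqrtrM ?vE //; lra.
have m2 : Num.sqrt (t / (2 - t)) = Num.sqrt t / Num.sqrt (2 - t).
  by rewrite sqrtrM ?vE.
have aE : (Num.sqrt (2 - t))^-1 ^+ 2 = (2 - t)^-1 by rewrite exprVn sE.
rewrite m1 m2; move: (Num.sqrt (2 - t)) (Num.sqrt (1 - t)) (Num.sqrt t)
  sE cE dE sn aE => s c d sE cE dE sn aE.
exists s^-1, (s^-1 * c), c, d; split=> //; last split.
- by rewrite invr_eq0.
- by rewrite exprMn aE cE; field.
- by rewrite cE dE; ring.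
- have -> : s^-1 + s^-1 * c * c = s^-1 * (1 + c ^+ 2) by ring.
  by rewrite cE (_ : 1 + (1 - t) = s ^+ 2); [field | rewrite sE; ring].
- have -> : 2 * s^-1 * (s^-1 * c) * c = 2 * (s^-1 ^+ 2 * c ^+ 2) by ring.
  by rewrite aE cE; field.
- by ring.
- by ring.
Qed.

Lemma f_entries (R : realType) (t : R) (Z : 'M[R[i]]_2) (a b c d : R) :
  Num.sqrt (1 - t) = c -> Num.sqrt t = d ->
  [/\ Num.sqrt (2 - t) = a + b * c,
      2 * (1 - t) / (2 - t) = 2 * a * b * c,
      2 * Num.sqrt ((1 - t) / (2 - t)) = a * c + b &
      Num.sqrt (t / (2 - t)) = a * d] ->
  f_ t Z = mx_of_rows 4 4
  [:: [:: Z 0 0 ^+ 2; (a%:C + b%:C * c%:C) * Z 0 0 * Z 0 1;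
          c%:C * Z 0 1 ^+ 2; d%:C * Z 0 1];
      [:: (a%:C + b%:C * c%:C) * Z 0 0 * Z 1 0;
          2 * a%:C * b%:C * c%:C * Z 0 0 * Z 1 1 + Z 0 1 * Z 1 0;
          (a%:C * c%:C + b%:C) * Z 0 1 * Z 1 1; a%:C * d%:C * Z 1 1];
      [:: c%:C * Z 1 0 ^+ 2; (a%:C * c%:C + b%:C) * Z 1 0 * Z 1 1;
          Z 1 1 ^+ 2; 0];
      [:: d%:C * Z 1 0; a%:C * d%:C * Z 1 1; 0; 0]].
Proof.
move=> e5 e6 [e1 e2 e3 e4]; rewrite /f_ e1 e2 e3 e4 e5 e6.
by rewrite !(rmorphD, rmorphM, rmorph_nat).
Qed.

(** The adjoint of [f_ t Z] has the coefficients of [f_ t], which are real,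
and the variables of [Z ^t*]; it factors as in [two_stage_contraction]. *)
Lemma f_self_map (R : realType) (t : R) (Z : 'M[R[i]]_2) : 0 <= t <= 1 ->
  OmegaI R[i] 2 2 Z -> OmegaI R[i] 4 4 (f_ t Z).
Proof.
move=> t01 /OmegaI_sqn hZ; apply/OmegaI_sqn => v [i0 vi0].
have [a [b [c [d [a0 ab cd [e5 e6] /(f_entries Z e5 e6) ->]]]]] := coefficient_identities t01.
rewrite !sum4; set v0 := v (Ordinal _); set v1 := v (Ordinal _).
set v2 := v (Ordinal _); set v3 := v (Ordinal _).
have abC : a%:C ^+ 2 + b%:C ^+ 2 = 1 :> R[i].
  by rewrite -!rmorphXn -rmorphD /= ab.
have v_neq0 : sqn v0 + sqn v1 + sqn v2 + sqn v3 != 0.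
  rewrite -(sum4 (fun i => sqn (v i))); apply: contraNneq vi0 => sum0.
  rewrite -sqn_eq0; apply/eqP; apply: (psumr_eq0P _ sum0) => // i _.
  exact: sqn_ge0.
have hZ2 x y : sqn x + sqn y != 0 ->
    sqn (conjc (Z 0 0) * x + conjc (Z 1 0) * y) +
    sqn (conjc (Z 0 1) * x + conjc (Z 1 1) * y) < sqn x + sqn y.
  move=> xy; have := hZ (fun i => if i == 0 then x else y).
  rewrite !sum2 /=; apply; apply: contrapT => n.
  have z (i : 'I_2) : (if i == 0 then x else y) = 0.
    by apply: contrapT => ni; apply: n; exists i; apply/eqP.
  by move: xy (z 0) (z 1) => /= + x0 y0; rewrite x0 y0 sqn0 addr0 eqxx.
have := two_stage_contraction hZ2 ab cd a0 v_neq0.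
have cD (z w : R[i]) : conjc (z + w) = conjc z + conjc w by exact: rmorphD.
have cM (z w : R[i]) : conjc (z * w) = conjc z * conjc w by exact: rmorphM.
have c0 : Complex 0 (- 0) = 0 :> R[i] by rewrite oppr0.
rewrite /mx_of_rows !mxE /= !(c0, cD, cM, expr2, conjc_real, conjc_nat).
congr (sqn _ + sqn _ + sqn _ + sqn _ < _); try ring.
(* The coefficient of [z2 z3] arises as [a^2 + b^2]. *)
rewrite -[X in _ = _ + (_ + X) * _ + _ + _]mul1r -abC.
ring.
Qed.

(** * The differential of f_t *)

Definition f_differential (R : realType) (t : R) (Z Y : 'M[R[i]]_(2, 2)) : 'M[R[i]]_(4, 4) :=
  let z1 := Z 0 0 in let z2 := Z 0 1 in
  let z3 := Z 1 0 in let z4 := Z 1 1 in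
  let y1 := Y 0 0 in let y2 := Y 0 1 in
  let y3 := Y 1 0 in let y4 := Y 1 1 in
  mx_of_rows 4 4
  [:: [:: 2 * (z1 * y1);
          (Num.sqrt (2 - t))%:C * (z1 * y2 + z2 * y1);
          (Num.sqrt (1 - t))%:C * (2 * (z2 * y2));
          (Num.sqrt t)%:C * y2];
      [:: (Num.sqrt (2 - t))%:C * (z1 * y3 + z3 * y1);
          (2 * (1 - t) / (2 - t))%:C * (z1 * y4 + z4 * y1)
            + (z2 * y3 + z3 * y2);
          (2 * Num.sqrt ((1 - t) / (2 - t)))%:C * (z2 * y4 + z4 * y2);
          (Num.sqrt (t / (2 - t)))%:C * y4];
      [:: (Num.sqrt (1 - t))%:C * (2 * (z3 * y3));
          (2 * Num.sqrt ((1 - t) / (2 - t)))%:C * (z3 * y4 + z4 * y3);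
          2 * (z4 * y4);
          0];
      [:: (Num.sqrt t)%:C * y3;
          (Num.sqrt (t / (2 - t)))%:C * y4;
          0;
          0]].

(** Differentiation along a curve, which is the form in which the chain rule
is needed. *)
Lemma f_has_cderiv (R : realType) (t : R) (g : R[i] -> 'M[R[i]]_(2, 2))
    (z : R[i]) (D : 'M[R[i]]_(2, 2)) :
  (forall i j, has_cderiv (fun u => g u i j) z (D i j)) ->
  forall i j, has_cderiv (fun u => f_ t (g u) i j) z (f_differential t (g z) D i j).
Proof.
move=> gD.
pose z0 := @has_cderiv_cst R[i] 0 z.
have lin k i j : has_cderiv (fun u => k * g u i j) z (k * D i j).
  exact: has_cderivZ.
have quad k i j i' j' : has_cderiv (fun u => k * g u i j * g u i' j') z
    (k * (g z i j * D i' j' + g z i' j' * D i j)).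
  apply: has_cderiv_ext (has_cderivM (lin k i j) (gD i' j')) _ _ => //; ring.
have sqr k i j : has_cderiv (fun u => k * g u i j ^+ 2) z (k * (2 * (g z i j * D i j))).
  apply: has_cderiv_ext (quad k i j i j) _ _; last by ring.
  by apply/funext => u; ring.
have sqr1 i j : has_cderiv (fun u => g u i j ^+ 2) z (2 * (g z i j * D i j)).
  apply: has_cderiv_ext (sqr 1 i j) _ _; last by rewrite mul1r.
  by apply/funext => u; rewrite mul1r.
have quad1 i j i' j' : has_cderiv (fun u => g u i j * g u i' j') z
    (g z i j * D i' j' + g z i' j' * D i j) by exact: has_cderivM.
Ltac entry H := apply: has_cderiv_ext H _ _;
  [by apply/funext => u; rewrite /f_ mxE | by rewrite mxE].
apply: ord4_cases; apply: ord4_cases.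
- by entry (sqr1 0 0).
- by entry (quad (Num.sqrt (2 - t))%:C 0 0 0 1).
- by entry (sqr (Num.sqrt (1 - t))%:C 0 1).
- by entry (lin (Num.sqrt t)%:C 0 1).
- by entry (quad (Num.sqrt (2 - t))%:C 0 0 1 0).
- by entry (has_cderivD (quad (2 * (1 - t) / (2 - t))%:C 0 0 1 1) (quad1 0 1 1 0)).
- by entry (quad (2 * Num.sqrt ((1 - t) / (2 - t)))%:C 0 1 1 1).
- by entry (lin (Num.sqrt (t / (2 - t)))%:C 1 1).
- by entry (sqr (Num.sqrt (1 - t))%:C 1 0).
- by entry (quad (2 * Num.sqrt ((1 - t) / (2 - t)))%:C 1 0 1 1).
- by entry (sqr1 1 1).
- by entry (z0).
- by entry (lin (Num.sqrt t)%:C 1 0).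
- by entry (lin (Num.sqrt (t / (2 - t)))%:C 1 1).
- by entry (z0).
- by entry (z0).
Qed.

(** For [k = 1] the quantities assumed to vanish are the coefficients of the
product of the bilinear forms with matrices [z] and [y], so that the lemma says
that polynomials have no zero divisors.  It survives the weight [k] because the
equation carrying it is only used once all but one of its terms are known to
vanish. *)
Lemma weighted_square_product_eq0 (F : idomainType)
    (k z1 z2 z3 z4 y1 y2 y3 y4 : F) : k != 0 ->
  z1 * y1 = 0 -> z2 * y2 = 0 -> z3 * y3 = 0 -> z4 * y4 = 0 ->
  z1 * y2 + z2 * y1 = 0 -> z1 * y3 + z3 * y1 = 0 ->
  z2 * y4 + z4 * y2 = 0 -> z3 * y4 + z4 * y3 = 0 ->
  k * (z1 * y4 + z4 * y1) + (z2 * y3 + z3 * y2) = 0 ->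
  [/\ y1 = 0, y2 = 0, y3 = 0 & y4 = 0] \/ [/\ z1 = 0, z2 = 0, z3 = 0 & z4 = 0].
Proof.
move=> k0 e11 e22 e33 e44 e12 e13 e24 e34 e14.
have cancel (z y : F) : y != 0 -> z * y = 0 -> z = 0.
  by move=> y0 /eqP; rewrite mulf_eq0 (negbTE y0) orbF => /eqP.
have [y10|y10] := eqVneq y1 0; last first.
  have z10 := cancel _ _ y10 e11; move: e12 e13 e14; rewrite z10 !mul0r !add0r.
  move=> /(cancel _ _ y10) z20 /(cancel _ _ y10) z30.
  rewrite z20 z30 !mul0r !addr0 mulrA => /(cancel _ _ y10)/eqP.
  by rewrite mulf_eq0 (negbTE k0) => /eqP z40; right.
have [y40|y40] := eqVneq y4 0; last first.
  have z40 := cancel _ _ y40 e44; move: e24 e34 e14; rewrite z40 !mul0r !addr0.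
  move=> /(cancel _ _ y40) z20 /(cancel _ _ y40) z30.
  rewrite z20 z30 !mul0r !addr0 mulrA => /(cancel _ _ y40)/eqP.
  by rewrite mulf_eq0 (negbTE k0) => /eqP z10; right.
move: e12 e13 e24 e34 e14; rewrite y10 y40 !(mulr0, addr0, add0r).
have [y20|y20] := eqVneq y2 0; last first.
  move=> /(cancel _ _ y20) z10 _ /(cancel _ _ y20) z40 _.
  have z20 := cancel _ _ y20 e22; rewrite z20 mul0r add0r.
  by move=> /(cancel _ _ y20) z30; right.
have [y30|y30] := eqVneq y3 0; first by left.
move=> _ /(cancel _ _ y30) z10 _ /(cancel _ _ y30) z40.
have z30 := cancel _ _ y30 e33; rewrite z30 mul0r addr0.
by move=> /(cancel _ _ y30) z20; right.
Qed.

(** The quadratic entries of [f_ t] alone are an immersion away from the origin.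
For [t = 1] the weight of [z1 z4] vanishes and this breaks down on the [z4]
axis. *)
Lemma critical_points (R : realType) (t : R) (Z Y : 'M[R[i]]_(2, 2)) :
  0 <= t < 1 -> f_differential t Z Y = 0 -> Y != 0 -> Z = 0.
Proof.
move=> /andP[t0 t1] dfE Y0.
have E k l (hk : (k < 4)%N) (hl : (l < 4)%N) : f_differential t Z Y (Ordinal hk) (Ordinal hl) = 0.
  by rewrite dfE mxE.
have C0 (x : R) : 0 < x -> x%:C != 0.
  by move=> x0; rewrite -[0]/(0%:C) (inj_eq (@complexI R)) gt_eqF.
have cancel (k z : R[i]) : k != 0 -> k * z = 0 -> z = 0.
  by move=> k0 /eqP; rewrite mulf_eq0 (negbTE k0) => /eqP.
have two : (2 : R[i]) != 0 by rewrite pnatr_eq0.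
have k1 : (Num.sqrt (2 - t))%:C != 0 by apply: C0; rewrite sqrtr_gt0; lra.
have k2 : (Num.sqrt (1 - t))%:C != 0 by apply: C0; rewrite sqrtr_gt0; lra.
have k3 : (2 * (1 - t) / (2 - t))%:C != 0.
  by apply: C0; rewrite !(mulr_gt0, invr_gt0) //; lra.
have k4 : (2 * Num.sqrt ((1 - t) / (2 - t)))%:C != 0.
  by apply: C0; rewrite mulr_gt0 // sqrtr_gt0 divr_gt0 //; lra.
have e11 : Z 0 0 * Y 0 0 = 0 by apply: (cancel 2) => //; have := E 0 0 isT isT; rewrite mxE.
have e22 : Z 0 1 * Y 0 1 = 0.
  by apply: (cancel 2) => //; apply: (cancel _ _ k2); have := E 0 2 isT isT; rewrite mxE.
have e33 : Z 1 0 * Y 1 0 = 0.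
  by apply: (cancel 2) => //; apply: (cancel _ _ k2); have := E 2 0 isT isT; rewrite mxE.
have e44 : Z 1 1 * Y 1 1 = 0 by apply: (cancel 2) => //; have := E 2 2 isT isT; rewrite mxE.
have e12 : Z 0 0 * Y 0 1 + Z 0 1 * Y 0 0 = 0.
  by apply: (cancel _ _ k1); have := E 0 1 isT isT; rewrite mxE.
have e13 : Z 0 0 * Y 1 0 + Z 1 0 * Y 0 0 = 0.
  by apply: (cancel _ _ k1); have := E 1 0 isT isT; rewrite mxE.
have e24 : Z 0 1 * Y 1 1 + Z 1 1 * Y 0 1 = 0.
  by apply: (cancel _ _ k4); have := E 1 2 isT isT; rewrite mxE.
have e34 : Z 1 0 * Y 1 1 + Z 1 1 * Y 1 0 = 0.
  by apply: (cancel _ _ k4); have := E 2 1 isT isT; rewrite mxE.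
have e14 := E 1 1 isT isT; rewrite mxE /= in e14.
have mx0 (M : 'M[R[i]]_(2, 2)) : M 0 0 = 0 -> M 0 1 = 0 -> M 1 0 = 0 ->
    M 1 1 = 0 -> M = 0.
  move=> m1 m2 m3 m4; apply/matrixP => i j; rewrite mxE.
  have ord2 (a : 'I_2) : a = 0 \/ a = 1.
    by case: a => [[|[|?]] ?] //; [left|right]; exact: val_inj.
  by have [->|->] := ord2 i; have [->|->] := ord2 j.
have [[y1 y2 y3 y4]|[z1 z2 z3 z4]] :=
  weighted_square_product_eq0 k3 e11 e22 e33 e44 e12 e13 e24 e34 e14.
  by case/eqP: Y0; exact: mx0.
exact: mx0.
Qed.

Lemma f_at_zero (R : realType) (t : R) : f_ t 0 = 0.
Proof.
apply/matrixP; apply: ord4_cases; apply: ord4_cases; rewrite /f_ mxE /=;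
  by rewrite !mxE ?expr0n ?(mulr0, addr0).
Qed.

(** Factoring out [sqrt t] exhibits the operator norm of the differential. *)
Lemma f_differential_at_zero (R : realType) (t : R) (Y : 'M[R[i]]_(2, 2)) : 0 <= t <= 1 ->
  f_differential t 0 Y = (Num.sqrt t)%:C *: mx_of_rows 4 4
   [:: [:: 0; 0; 0; Y 0 1];
       [:: 0; 0; 0; (Num.sqrt (2 - t)^-1)%:C * Y 1 1];
       [:: 0; 0; 0; 0];
       [:: Y 1 0; (Num.sqrt (2 - t)^-1)%:C * Y 1 1; 0; 0]].
Proof.
move=> /andP[t0 t1]; have e : Num.sqrt (t / (2 - t)) = Num.sqrt t * Num.sqrt (2 - t)^-1.
  by rewrite sqrtrM.
apply/matrixP; apply: ord4_cases; apply: ord4_cases;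
  rewrite /f_differential [LHS]mxE [RHS]mxE [in RHS]mxE /=;
  by rewrite ?mxE ?e ?rmorphM /= ?(mulr0, mul0r, addr0, mulrA).
Qed.

Lemma linear_part_contraction (R : realType) (k : R) (Y : 'M[R[i]]_(2, 2)) :
  k ^+ 2 <= 1 -> contraction Y ->
  contraction (mx_of_rows 4 4
   [:: [:: 0; 0; 0; Y 0 1]; [:: 0; 0; 0; k%:C * Y 1 1]; [:: 0; 0; 0; 0];
       [:: Y 1 0; k%:C * Y 1 1; 0; 0]]).
Proof.
move=> k1 cY v; have := contraction_row 1 cY; have := contraction_col 1 cY.
rewrite !sum2 !sum4 => col row.
have c0 : Complex 0 (- 0) = 0 :> R[i] by rewrite oppr0.
have kY : sqn (conjc (k%:C * Y 1 1)) <= sqn (Y 1 1).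
  by rewrite sqn_conj sqnM sqn_real ler_piMl // sqn_ge0.
rewrite /mx_of_rows !mxE /= !(c0, mul0r, add0r, addr0, sqn0) !(sqnM _ (v _)).
have := sqn_cauchy (conjc (Y 0 1)) (conjc (k%:C * Y 1 1))
  (v o4_0) (v o4_1).
move: kY; rewrite !(sqn_conj (Y _ _)); move: (sqn (conjc _)) => y kY cauchy.
have v3 := sqn_ge0 (v o4_3).
have v01 := addr_ge0 (sqn_ge0 (v o4_0)) (sqn_ge0 (v o4_1)).
have b1 : (sqn (Y 1 0) + y) * sqn (v o4_3) <=
    1 * sqn (v o4_3) by rewrite ler_wpM2r //; lra.
have b2 := ler_wpM2r v01 (_ : sqn (Y 0 1) + y <= 1).
have {}b2 : (sqn (Y 0 1) + y) * (sqn (v o4_0) + sqn (v o4_1))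
    <= 1 * (sqn (v o4_0) + sqn (v o4_1)).
  by apply: b2; lra.
have v2 := sqn_ge0 (v o4_2).
lra.
Qed.

(** * Inequivalence *)

(** Only the inequality [s < t] in this direction leads to a contradiction: it
makes [s < 1] available for [critical_points] and contradicts [t <= s], which the
Schwarz lemma yields. *)
Lemma no_equivalence_lt (R : realType) (s t : R) (A B : _ -> _) :
  0 <= s -> s < t -> t <= 1 ->
  is_aut (OmegaI R[i] 4 4) A -> is_aut (OmegaI R[i] 2 2) B ->
  (forall Z, OmegaI R[i] 2 2 Z -> f_ t Z = A (f_ s (B Z))) -> False.
Proof.
move=> s0 st t1 [AO dA [A' [A'O dA' A'K AK']]] [BO dB [B' [B'O dB' B'K BK']]] fE.
have s01 : 0 <= s <= 1 by lra.
have t01 : 0 <= t <= 1 by lra.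
pose O := OmegaI R[i] 2 2.
have inO i j (z : R[i]) : `|z| < 1 -> O (z *: delta_mx i j).
  by apply: scaled_contraction; exact: contraction_delta.
have z1 : `|0 : R[i]| < 1 by rewrite normr0.
(* The curve [f_ t (z E1)] has derivative 0 at 0, whereas [g z = B (z E1)] has a
   nonzero one; this forces [g 0] to be a critical point of [f_ s]. *)
pose E1 : 'M[R[i]]_(2, 2) := delta_mx 0 0.
pose w (z : R[i]) : 'M[R[i]]_(2, 2) := z *: E1.
pose g (z : R[i]) : 'M[R[i]]_(2, 2) := B (w z).
pose D := mxdiff B (w 0) E1.
have gD i j : has_cderiv (fun u => g u i j) 0 (D i j).
  by apply: has_cderiv_mx => [|k l]; [apply: dB; exact: inO | exact: has_cderiv_line].
have D0 : D != 0.
  apply/eqP => D0.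
  have : has_cderiv (fun u => B' (g u) 0 0) 0 (mxdiff B' (g 0) D 0 0).
    by apply: has_cderiv_mx => //; apply: dB'; apply: BO; exact: inO.
  rewrite D0 mxdiff0 mxE => h0.
  have h1 : has_cderiv (fun u => B' (g u) 0 0) 0 1.
    have := has_cderiv_line E1 0 0 0; rewrite [E1 0 0]mxE.
    apply: (has_cderiv_near ltr01) => z; rewrite subr0 => z1'.
    by rewrite /g B'K //; exact: inO.
  by have /eqP := has_cderiv_unique h0 h1; rewrite eq_sym oner_eq0.
have fgE z : `|z| < 1 -> A' (f_ t (w z)) = f_ s (g z).
  move=> zz; rewrite fE ?A'K //; last exact: inO.
  by apply: f_self_map => //; apply: BO; exact: inO.
have dfD : f_differential s (g 0) D = 0.
  apply/matrixP => i j; rewrite [RHS]mxE.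
  have h1 := f_has_cderiv s gD i j.
  have dft0 : f_differential t (w 0) E1 = 0.
    rewrite /w scale0r f_differential_at_zero //; apply/matrixP.
    by apply: ord4_cases; apply: ord4_cases; rewrite !mxE /= ?mxE ?mulr0.
  have h2 : has_cderiv (fun u => A' (f_ t (w u)) i j) 0 0.
    have := @has_cderiv_mx R[i] _ _ _ _ A' (fun u => f_ t (w u)) 0
      (f_differential t (w 0) E1) _ _ i j.
    rewrite dft0 mxdiff0 mxE; apply.
      by apply: dA'; apply: f_self_map => //; exact: inO.
    rewrite -dft0.
    by apply: f_has_cderiv => k' l'; exact: has_cderiv_line.
  apply: has_cderiv_unique h1 _; apply: has_cderiv_near ltr01 _ h2 => z.
  by rewrite subr0 => /fgE ->.
have B0 : B 0 = 0.
  have := critical_points _ dfD D0; rewrite /g /w scale0r; apply; lra.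
have A0 : A 0 = 0.
  have := fE 0; rewrite B0 !f_at_zero => <- //.
  by have := inO 0 0 0 z1; rewrite scale0r.
(* The norm of the differential of [f_ t] at 0 is attained at [E2]. *)
pose E2 : 'M[R[i]]_(2, 2) := delta_mx 0 1.
pose Y := mxdiff B 0 E2.
have cE2 : contraction E2 by exact: contraction_delta.
have cY : contraction Y := schwarz_contraction BO dB B0 cE2.
pose X := mx_of_rows 4 4
   [:: [:: 0; 0; 0; Y 0 1]; [:: 0; 0; 0; (Num.sqrt (2 - s)^-1)%:C * Y 1 1];
       [:: 0; 0; 0; 0]; [:: Y 1 0; (Num.sqrt (2 - s)^-1)%:C * Y 1 1; 0; 0]].
have cX : contraction X.
  apply: linear_part_contraction => //; rewrite sqr_sqrtr ?invr_ge0; last by lra.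
  by rewrite invf_le1; lra.
have cL : contraction (mxdiff A 0 X) := schwarz_contraction AO dA A0 cX.
set L := mxdiff A 0 X in cL.
pose w2 (z : R[i]) : 'M[R[i]]_(2, 2) := z *: E2.
have w20 : w2 0 = 0 by rewrite /w2 scale0r.
have tE : (Num.sqrt t)%:C = (Num.sqrt s)%:C * L o4_0 o4_3.
  have h1 : has_cderiv (fun u => f_ t (w2 u) o4_0 o4_3) 0
      (f_differential t (w2 0) E2 o4_0 o4_3).
    by apply: f_has_cderiv => k l; exact: has_cderiv_line.
  have -> : (Num.sqrt t)%:C = f_differential t (w2 0) E2 o4_0 o4_3.
    by rewrite w20 f_differential_at_zero // !mxE /= ?mxE mulr1.
  have hB i j : has_cderiv (fun u => B (w2 u) i j) 0 (Y i j).
    have := @has_cderiv_mx R[i] _ _ _ _ B w2 0 E2 _ _ i j; rewrite w20; apply.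
      by rewrite -w20; apply: dB; exact: inO.
    by move=> k l; exact: has_cderiv_line.
  have hf i j : has_cderiv (fun u => f_ s (B (w2 u)) i j) 0 (f_differential s 0 Y i j).
    by have := f_has_cderiv s hB i j; rewrite w20 B0.
  have h2 : has_cderiv (fun u => A (f_ s (B (w2 u))) o4_0 o4_3) 0
      (mxdiff A 0 (f_differential s 0 Y) o4_0 o4_3).
    have := @has_cderiv_mx R[i] _ _ _ _ A (fun u => f_ s (B (w2 u))) 0 (f_differential s 0 Y) _ hf.
    rewrite w20 B0 f_at_zero; apply.
    by apply: dA; rewrite -(f_at_zero s); apply: f_self_map => //; rewrite -w20; exact: inO.
  have -> : (Num.sqrt s)%:C * L o4_0 o4_3 =
      mxdiff A 0 (f_differential s 0 Y) o4_0 o4_3.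
    by rewrite f_differential_at_zero // mxdiffZ [RHS]mxE.
  apply: has_cderiv_unique h1 _; apply: has_cderiv_near ltr01 _ h2 => z.
  by rewrite subr0 => zz; rewrite fE //; exact: inO.
(* [L] is a contraction, so its entries have modulus at most 1. *)
have L3 : sqn (L o4_0 o4_3) <= 1.
  have := contraction_row o4_0 cL; rewrite sum4.
  have l0 := sqn_ge0 (L o4_0 o4_0).
  have l1 := sqn_ge0 (L o4_0 o4_1).
  have l2 := sqn_ge0 (L o4_0 o4_2).
  by lra.
have := congr1 (@sqn R) tE; rewrite sqnM !sqn_real !sqr_sqrtr //; last by lra.
have := ler_wpM2l s0 L3.
by lra.
Qed.

Theorem corollary4p2 (R : realType) (s t : R)
    (hs : 0 <= s <= 1) (ht : 0 <= t <= 1) (hst : s <> t) :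
  ~ equivalent_maps (OmegaI R[i] 2 2) (OmegaI R[i] 4 4) (f_ s) (f_ t).
Proof.
move=> [A [B [autA autB fE]]].
have [s0 s1] := andP hs; have [t0 t1] := andP ht.
have [st|ts|//] := ltgtP s t; last first.
  exact: (no_equivalence_lt t0 ts s1 autA autB fE).
have [AO dA [A' [A'O dA' A'K AK']]] := autA.
have [BO dB [B' [B'O dB' B'K BK']]] := autB.
apply: (@no_equivalence_lt R s t A' B') => //.
- split; [exact: A'O | exact: dA' | exists A; split];
    [exact: AO | exact: dA | exact: AK' | exact: A'K].
- split; [exact: B'O | exact: dB' | exists B; split];
    [exact: BO | exact: dB | exact: BK' | exact: B'K].
- move=> Z ZO; rewrite fE; last exact: B'O.
  by rewrite BK' // A'K //; exact: f_self_map.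
Qed.
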